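(* Let $(X,\mu)$ be a connected $d$-partite top-link path complex which is a $\tfrac12$-top-link spectral expander. Then $(X,\mu)$ is a $\tfrac12$-local spectral expander; that is, $\lambda_2(P_\tau)\le \tfrac12$ for every face $\tau\in X$ with $\operatorname{codim}(\tau)\ge 2$.
   Context: A simplicial complex $X$ on a finite ground set is a downward-closed family of subsets (faces). For a face $\tau$, $\dim(\tau)=|\tau|$; $X(i)$ is the set of faces of size $i$; $X$ is pure $d$-dimensional if every maximal face (facet) has size $d$, and $\operatorname{codim}(\tau)=d-|\tau|$. The link of $\tau$ is $X_\tau=\{\sigma\setminus\tau:\sigma\in X,\sigma\supseteq\tau\}$. $X$ is $d$-partite if $X(1)$ is partitioned into $T_1,\dots,T_d$ with $|\sigma\cap T_i|=1$ for every facet $\sigma$ and every $i$. Let $\mu:X(d)\to\mathbb{R}_{>0}$ be a probability distribution on the facets. For a face $\tau$ with $\operatorname{codim}(\tau)\ge 2$, $G_\tau$ is the weighted graph with vertex set $X_\tau(1)$, edge set $X_\tau(2)$ and edge weights $w_\tau(F,G)=\mathbb{P}_{\sigma\sim\mu}[F,G\in\sigma\mid \tau\subseteq\sigma]$, and $P_\tau$ is the transition matrix of the simple random walk on $G_\tau$, $P_\tau(F,G)=w_\tau(F,G)/\sum_H w_\tau(F,H)$; $\lambda_2$ denotes the second largest eigenvalue. $(X,\mu)$ is connected if $G_\tau$ is connected for every $\tau$ with $\operatorname{codim}(\tau)\ge2$. $(X,\mu)$ is an $\alpha$-local spectral expander if $\lambda_2(P_\tau)\le\alpha$ for all faces $\tau$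 with $\operatorname{codim}(\tau)\ge 2$, and an $\alpha$-top-link spectral expander if $\lambda_2(P_\tau)\le\alpha$ for all $\tau$ with $\operatorname{codim}(\tau)=2$. A $d$-partite $(X,\mu)$ is a top-link path complex if (after possibly renaming the parts) for all $1\le i<k-1\le d-1$, all $F\in T_i$, $K\in T_k$ and every face $\tau$ with $\operatorname{codim}(\tau)=2$ and $\tau\cap\bigcup_{j=i+1}^{k-1}T_j\neq\emptyset$, we have $\mathbb{P}_{\sigma\sim\mu}[F,K\in\sigma\mid\tau\subseteq\sigma]=\mathbb{P}_{\sigma\sim\mu}[F\in\sigma\mid\tau\subseteq\sigma]\cdot\mathbb{P}_{\sigma\sim\mu}[K\in\sigma\mid\tau\subseteq\sigma]$. *)

(* Defs.v *)
From HB Require Import structures.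
From mathcomp Require Import all_boot all_order all_algebra perm.
From mathcomp Require Import polyrcf.
From mathcomp Require Import reals.

Set Implicit Arguments.
Unset Strict Implicit.
Unset Printing Implicit Defensive.

Import Order.TTheory GRing.Theory Num.Theory.
Local Open Scope ring_scope.

(* All eigenvalues lying in R, repeated according to their multiplicity as
   roots of the characteristic polynomial, in nonincreasing order. *)
Definition eigenvalues (R : rcfType) (n : nat) (A : 'M[R]_n) : seq R :=
  sort >=%R (flatten [seq nseq (mup x (char_poly A)) x
                     | x <- rootsR (char_poly A)]).

(* The default value 0 is returned only if A has fewer than two eigenvalues in
   R. For the transition matrices below, all eigenvalues are real (the walk is
   reversible) and there are at least two of them (codimension at least 2). *)
Definition lambda2 (R : rcfType) (n : nat) (A : 'M[R]_n) : R :=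
  nth 0 (eigenvalues A) 1.

Section Complexes.

Variable V : finType.
Implicit Types (X : {set {set V}}) (s t tau : {set V}) (d : nat).

Definition simplicial_complex X : Prop :=
  forall s t, s \in X -> t \subset s -> t \in X.

Definition faces X (i : nat) : {set {set V}} := [set s in X | #|s| == i].

Definition vertices X : {set V} := [set v | [set v] \in faces X 1].

(* dim tau = #|tau|, so that facets have dimension d. *)
Definition codim d tau : nat := (d - #|tau|)%N.

Definition pure X d : Prop :=
  forall s, maxset (fun t => t \in X) s -> #|s| = d.

Definition link X tau : {set {set V}} :=
  [set s :\: tau | s in X & tau \subset s].

(* In a pure d-dimensional complex, the facets are the elements of faces X d. *)
Definition partite X d (T : 'I_d -> {set V}) : Prop :=
  [/\ \bigcup_(i < d) T i = vertices X,
      forall i j : 'I_d, i != j -> [disjoint T i & T j]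
    & forall s, s \in faces X d -> forall i : 'I_d, #|s :&: T i| = 1%N].

Section Weighted.

Variable R : realType.
(* The values of mu outside faces X d are never used. *)
Implicit Types (mu : {set V} -> R) (alpha : R).

Definition facet_distribution X d mu : Prop :=
  (forall s, s \in faces X d -> 0 < mu s) /\ \sum_(s in faces X d) mu s = 1.

Definition prob X d mu (E : pred {set V}) : R :=
  \sum_(s in faces X d | E s) mu s.

Definition cprob X d mu (E B : pred {set V}) : R :=
  prob X d mu (fun s => E s && B s) / prob X d mu B.

Definition link_edge X tau : rel V :=
  fun F G => [set F; G] \in faces (link X tau) 2.

Definition link_weight X d mu tau (F G : V) : R :=
  if link_edge X tau F G
  then cprob X d mu (fun s => (F \in s) && (G \in s)) (fun s => tau \subset s)
  else 0.

Definition link_walk X d mu tau :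
    'M[R]_(#|vertices (link X tau)|) :=
  \matrix_(i, j)
    (link_weight X d mu tau (enum_val i) (enum_val j)
     / \sum_(H in vertices (link X tau)) link_weight X d mu tau (enum_val i) H).

Definition link_connected X tau : Prop :=
  {in vertices (link X tau) &, forall F G, connect (link_edge X tau) F G}.

Definition connected_complex X d : Prop :=
  forall tau, tau \in X -> (2 <= codim d tau)%N -> link_connected X tau.

Definition local_spectral_expander X d mu alpha : Prop :=
  forall tau, tau \in X -> (2 <= codim d tau)%N ->
    lambda2 (link_walk X d mu tau) <= alpha.

Definition top_link_spectral_expander X d mu alpha : Prop :=
  forall tau, tau \in X -> codim d tau = 2%N ->
    lambda2 (link_walk X d mu tau) <= alpha.

(* The permutation p renames the parts. Parts are indexed from 0. *)
Definition top_link_path_complex X d (T : 'I_d -> {set V}) mu : Prop :=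
  exists p : 'S_d,
  forall (i k : 'I_d), (i.+1 < k)%N ->
  forall F K, F \in T (p i) -> K \in T (p k) ->
  forall tau, tau \in X -> codim d tau = 2%N ->
    tau :&: \bigcup_(j < d | (i < j < k)%N) T (p j) != set0 ->
    cprob X d mu (fun s => (F \in s) && (K \in s)) (fun s => tau \subset s)
    = cprob X d mu (fun s => F \in s) (fun s => tau \subset s)
      * cprob X d mu (fun s => K \in s) (fun s => tau \subset s).

End Weighted.

End Complexes.

(* Main.v *)
(* Sampling a facet through a face gives one random vertex per missing part.
   Conditioning on further vertices and using connectivity, these variables form
   a Markov chain along the path of parts.  If j < i are missing parts, and
   a < j, i < b are positions already fixed (or the ends of the path), their
   maximal correlation rho satisfies

     rho^2 <= (j - a)(b - i) / ((i - a)(b - j)),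

   the squared correlation of a Brownian bridge on [a, b] at times j and i, which is
   attained by the Coxeter complex of the symmetric group.  This is proved by
   induction on the codimension: for three variables X - Y - Z with X and Z
   independent given Y, if rho(X,Y|Z)^2 <= al and rho(Y,Z|X)^2 <= be, then
   rho(X,Y)^2 <= al / (1 - be).  Indeed, let phi(X) be an eigenfunction with
   eigenvalue s of the two-step walk X -> Y -> X, and let gam = E[phi|Y],
   eta = E[gam|Z], A = E phi^2, B = E eta^2; the two hypotheses give
   s A - B <= al (A - B) and B (1 - s) <= be s (A - B), whose sum is
   s <= al + be s.

   The bridge bound in the weighted form
     2 Cov(f_j, f_i) <= (b - i)/(b - j) Var f_j + (j - a)/(i - a) Var f_i
   sums over all pairs to Var(sum f_j) <= (1 + (k - 1)/2) sum (Var f_j) when k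
   parts are missing, which is lambda_2 <= 1/2. *)
Require Import Defs.
From HB Require Import structures.
From mathcomp Require Import all_boot all_order all_algebra perm.
From mathcomp Require Import polyrcf complex spectral sesquilinear.
From mathcomp Require Import reals ring lra zify.

Set Implicit Arguments.
Unset Strict Implicit.
Unset Printing Implicit Defensive.

Import Order.TTheory GRing.Theory Num.Theory.
Local Open Scope ring_scope.

(** * Characteristic polynomials of similar matrices, and the second entry of a sorted list *)

Lemma char_poly_conj (F : comUnitRingType) (n : nat) (P Q B : 'M[F]_n) :
  Q *m P = 1%:M -> char_poly (Q *m B *m P) = char_poly B.
Proof.
move=> QP; rewrite /char_poly.
have QP' : map_mx polyC Q *m map_mx polyC P = 1%:M by rewrite -map_mxM QP map_mx1.
have -> : char_poly_mx (Q *m B *m P)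
    = map_mx polyC Q *m char_poly_mx B *m map_mx polyC P.
  rewrite /char_poly_mx mulmxBr mulmxBl !map_mxM /=; congr (_ - _).
  by rewrite scalar_mxC -mulmxA QP' mulmx1.
by rewrite !det_mulmx mulrAC -det_mulmx QP' det1 mul1r.
Qed.

Section SortedSecond.
Variable R : realDomainType.

(** In a nonincreasing list the second entry is at most c exactly when nothing but the head can
    exceed c. The assumption [0 <= c] covers lists with fewer than two entries, where [nth] returns
    0. *)
Lemma sorted_nth1_le (l : seq R) (c : R) : 0 <= c ->
  (nth 0 (sort >=%R l) 1 <= c) = (count (fun x => (c < x)%R) l <= 1)%N.
Proof.
move=> c0; rewrite -(count_sort >=%R).
have ge_tot : total (>=%R : rel R) by move=> x y; exact: le_total.
have ge_tr : transitive (>=%R : rel R) by move=> x y z yx zy; exact: le_trans yx.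
move: (sort_sorted ge_tot l).
case: (sort _ l) => [|x [|y s]] /=; rewrite ?c0 ?addn0 ?leq_b1 //.
case/andP=> xy ys; have [yc|cy] := leP y c; last by rewrite (lt_le_trans cy xy) !addnA.
have -> : count (fun x => c < x) s = 0%N.
  apply/eqP; rewrite -leqn0 leqNgt -has_count; apply/hasPn => z zs.
  rewrite -leNgt (le_trans _ yc) //.
  by have /allP/(_ z zs) := order_path_min ge_tr ys.
by rewrite !addn0 leq_b1.
Qed.

End SortedSecond.

(** * Spectral theorem for real symmetric matrices and the variational form of [lambda2] *)

Section Spectral.
Variable R : rcfType.
Local Notation C := R[i].
Local Notation toC := (real_complex R).
Local Notation "v ^C" := (map_mx toC v) : ring_scope.
Local Open Scope sesquilinear_scope.

Lemma perm_eigenvalues (n : nat) (A : 'M[R]_n) (d : 'rV[R]_n) :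
  char_poly A = \prod_i ('X - (d 0 i)%:P) ->
  perm_eq (eigenvalues A) [seq d 0 i | i : 'I_n].
Proof.
move=> cA; rewrite /eigenvalues perm_sort.
have p0 : char_poly A != 0 by rewrite monic_neq0 ?char_poly_monic.
have mupE x : mup x (char_poly A) = count_mem x [seq d 0 i | i : 'I_n].
  rewrite cA count_map -sumn_count sumnE big_map big_enum /=.
  suff [] : mup x (\prod_(i < n) ('X - (d 0 i)%:P)) = (\sum_(i < n) (d 0%R i == x))%N
            /\ \prod_(i < n) ('X - (d 0 i)%:P) != 0 by [].
  elim/big_rec2: _ => [|i m p _ [<- p1]]; first by rewrite mupNroot ?root1 ?oner_eq0.
  have X0 : 'X - (d 0 i)%:P != 0 by rewrite polyXsubC_eq0.
  rewrite mulf_neq0 // mupM //; split=> //; congr (_ + _)%N.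
  by rewrite -['X - _]expr1 mup_XsubCX; case: eqP.
apply/allP => x _ /=; rewrite -mupE count_flatten -map_comp.
move: (char_poly A) p0 mupE => P P0 _.
have -> : [seq (count_mem x \o (fun y => nseq (mup y P) y)) i | i <- rootsR P]
    = [seq ((y == x) * mup x P)%N | y <- rootsR P].
  by apply: eq_map => y; rewrite /comp count_nseq /=; case: (eqVneq y x) => [->|_]; rewrite ?mul0n.
rewrite sumnE big_map -big_distrl /= -(big_map (fun y => y == x : nat) xpredT id) -sumnE.
rewrite sumn_count count_uniq_mem ?uniq_roots // -roots_on_rootsR //=.
by case: (boolP (root _ x)) => rx; rewrite ?mul1n ?mul0n // mupNroot.
Qed.

(** A real symmetric matrix is hermitian over [R[i]], so its spectral diagonal is real and descends
    to R. The unitary matrix U stays complex; for this reason the lemmas below work with complex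
    coordinates and split vectors into real and imaginary parts. *)
Lemma sym_spectral (n : nat) (A : 'M[R]_n) : A^T = A ->
  exists (U : 'M[C]_n) (d : 'rV[R]_n),
    [/\ U *m U^t* = 1%:M, U^t* *m U = 1%:M,
        A^C = U^t* *m diag_mx d^C *m U
      & char_poly A = \prod_i ('X - (d 0 i)%:P)].
Proof.
move=> symA.
have symAC : A^C \is symmetricmx.
  by apply/eqP; rewrite expr0 scale1r map_mx_id // map_trmx symA.
have realAC : A^C \is a mxOver Num.real.
  by apply/mxOverP => i j; rewrite mxE complex_real.
have hA := realsym_hermsym symAC realAC.
have /orthomx_spectralP := hermitian_normalmx hA.
have := spectral_unitarymx A^C; set U := spectralmx _ => uU.
have UU := unitarymxP uU.
have := hermitian_spectral_diag_real hA; set D := spectral_diag _ => /mxOverP rD.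
rewrite invmx_unitary // => eA.
have UU' : U^t* *m U = 1%:M by apply: mulmx1C.
pose d : 'rV[R]_n := map_mx (@complex.Re R) D.
have dD : d^C = D.
  by apply/rowP => i; rewrite !mxE RRe_real.
exists U, d; split => //; first by rewrite dD.
apply: (map_poly_inj toC); rewrite map_char_poly eA -/D char_poly_conj //.
rewrite char_poly_trig ?diag_mx_is_trig // rmorph_prod; apply: eq_bigr => i _.
by rewrite rmorphB /= map_polyX map_polyC /= -dD !mxE eqxx mulr1n.
Qed.

Lemma map_row_adjoint (n : nat) (v : 'rV[R]_n) : v^C^t* = v^T^C.
Proof. by apply/matrixP => i j; rewrite !mxE conj_Creal // complex_real. Qed.

Lemma complex_row_split (n : nat) (z : 'rV[C]_n) :
  exists x y : 'rV[R]_n, z = x^C + 'i *: y^C.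
Proof.
exists (map_mx (@complex.Re R) z), (map_mx (@complex.Im R) z).
by apply/rowP => i; rewrite !mxE {1}(complexE (z 0 i)).
Qed.

Lemma complex_row_adjoint (n : nat) (x y : 'rV[R]_n) :
  (x^C + 'i *: y^C)^t* = x^T^C - 'i *: y^T^C.
Proof.
apply/matrixP => i j; rewrite !mxE rmorphD rmorphM /= conjCi mulNr.
by congr (_ + - (_ * _)); apply: conj_Creal; rewrite complex_real.
Qed.

Section Coordinates.
Variables (n : nat) (A : 'M[R]_n) (U : 'M[C]_n) (d : 'rV[R]_n).
Hypothesis symA : A^T = A.
Hypotheses (UU : U *m U^t* = 1%:M) (UU' : U^t* *m U = 1%:M).
Hypothesis (AU : A^C = U^t* *m diag_mx d^C *m U).
Implicit Types z : 'rV[C]_n.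

Let coord z : 'rV[C]_n := z *m U^t*.

Lemma coordK z : coord z *m U = z.
Proof. by rewrite -mulmxA UU' mulmx1. Qed.

Lemma coord_mulmx z : coord (z *m U) = z.
Proof. by rewrite /coord -mulmxA UU mulmx1. Qed.

Lemma coord_dot z z' :
  (z *m z'^t*) 0 0 = \sum_i coord z 0 i * (coord z' 0 i)^*.
Proof.
rewrite -{1}(coordK z) -{1}(coordK z') trmx_mul map_mxM /= mulmxA.
rewrite -[coord z *m U *m _]mulmxA UU mulmx1 mxE.
by apply: eq_bigr => i _; rewrite !mxE.
Qed.

Lemma coord_mulA z i : coord (z *m A^C) 0 i = toC (d 0 i) * coord z 0 i.
Proof.
by rewrite /coord AU -!mulmxA UU mulmx1 mulmxA mul_mx_diag !mxE mulrC.
Qed.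

Lemma coord_quad z :
  (z *m A^C *m z^t*) 0 0 = \sum_i toC (d 0 i) * `|coord z 0 i| ^+ 2.
Proof.
by rewrite coord_dot; apply: eq_bigr => i _; rewrite coord_mulA -mulrA -normCK.
Qed.

Lemma coord_norm z : (z *m z^t*) 0 0 = \sum_i `|coord z 0 i| ^+ 2.
Proof. by rewrite coord_dot; apply: eq_bigr => i _; rewrite -normCK. Qed.

Lemma quad_real (v : 'rV[R]_n) :
  (v^C *m A^C *m v^C^t*) 0 0 = toC ((v *m A *m v^T) 0 0).
Proof. by rewrite map_row_adjoint -!map_mxM [LHS]mxE. Qed.

Lemma norm_real (v : 'rV[R]_n) : (v^C *m v^C^t*) 0 0 = toC ((v *m v^T) 0 0).
Proof. by rewrite map_row_adjoint -map_mxM [LHS]mxE. Qed.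

(** The cross terms cancel because A is symmetric. Inequalities known for real vectors thereby pass
    to complex ones. *)
Lemma quad_complex (x y : 'rV[R]_n) :
  let z := x^C + 'i *: y^C in
  (z *m A^C *m z^t*) 0 0 = toC ((x *m A *m x^T) 0 0 + (y *m A *m y^T) 0 0).
Proof.
rewrite /= complex_row_adjoint.
have xy : y *m A *m x^T = x *m A *m y^T.
  have <- : (y *m A *m x^T)^T = x *m A *m y^T by rewrite !trmx_mul trmxK symA mulmxA.
  by apply/matrixP => i j; rewrite [RHS]mxE !ord1.
rewrite !mulmxDl !mulmxBr -!scalemxAl -!scalemxAr scalerA mulCii scaleN1r opprK.
rewrite -!map_mxM xy addrA subrK.
move: (x *m A *m x^T) (y *m A *m y^T) => a c.
by rewrite !mxE rmorphD.
Qed.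

Lemma norm_complex (x y : 'rV[R]_n) :
  let z := x^C + 'i *: y^C in
  (z *m z^t*) 0 0 = toC ((x *m x^T) 0 0 + (y *m y^T) 0 0).
Proof.
rewrite /= complex_row_adjoint.
have xy : y *m x^T = x *m y^T.
  have <- : (y *m x^T)^T = x *m y^T by rewrite !trmx_mul trmxK.
  by apply/matrixP => i j; rewrite [RHS]mxE !ord1.
rewrite !mulmxDl !mulmxBr -!scalemxAl -!scalemxAr scalerA mulCii scaleN1r opprK.
rewrite -!map_mxM xy addrA subrK.
move: (x *m x^T) (y *m y^T) => a c.
by rewrite !mxE rmorphD.
Qed.

End Coordinates.

Lemma quad_le_eigen (n : nat) (A : 'M[R]_n) (c : R) : A^T = A ->
  (forall s (v : 'rV[R]_n), c < s -> v *m A = s *: v -> v = 0) ->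
  forall v : 'rV[R]_n, (v *m A *m v^T) 0 0 <= c * (v *m v^T) 0 0.
Proof.
move=> symA eigA v; have [U [d [UU UU' AU cA]]] := sym_spectral symA.
have dc i : d 0 i <= c.
  rewrite leNgt; apply/negP => /eigA ev.
  have /eigenvalueP[w /ev -> /eqP//] : eigenvalue A (d 0 i).
  by rewrite eigenvalue_root_char cA /root horner_prod (bigD1 i) //= !hornerE subrr mul0r.
rewrite -lecR rmorphM /= -quad_real -norm_real (coord_quad UU UU' AU) (coord_norm UU UU').
rewrite mulr_sumr; apply: ler_sum => i _.
by rewrite ler_wpM2r ?exprn_ge0 // lecR.
Qed.

(** Courant-Fischer with a known eigenvector e of eigenvalue 1 > c. If only one eigenvalue exceeds
    c, it is the one carrying e, and vectors orthogonal to e avoid it. Conversely, two eigenvalues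
    above c span a plane that contains a nonzero vector orthogonal to e, which violates the
    quadratic bound. *)
Lemma lambda2_quadP (n : nat) (A : 'M[R]_n) (e : 'rV[R]_n) (c : R) :
  A^T = A -> e != 0 -> e *m A = e -> 0 <= c < 1 ->
  lambda2 A <= c <->
  forall v : 'rV[R]_n, (v *m e^T) 0 0 = 0 ->
    (v *m A *m v^T) 0 0 <= c * (v *m v^T) 0 0.
Proof.
move=> symA e0 eA /andP[c0 c1]; have [U [d [UU UU' AU cA]]] := sym_spectral symA.
pose eps := e^C *m U^t*.
have epsd i : toC (d 0 i) * eps 0 i = eps 0 i.
  by rewrite -(coord_mulA UU AU) -map_mxM eA.
have eps0 : eps != 0.
  apply: contraNneq e0 => eps0; have := coordK UU' e^C; rewrite -/eps eps0 mul0mx.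
  by move/eqP; rewrite eq_sym map_mx_eq0.
have dotE (v : 'rV[R]_n) :
    toC ((v *m e^T) 0 0) = \sum_i (v^C *m U^t*) 0 i * (eps 0 i)^*.
  by rewrite -(coord_dot UU UU') map_row_adjoint -map_mxM [RHS]mxE.
have lamE : lambda2 A <= c = (#|[pred i | (c < d 0 i)%R]| <= 1)%N.
  have eig_perm := perm_eigenvalues cA.
  (* The list is already sorted; the second sort only gives it the shape required by
     [sorted_nth1_le]. *)
  have -> : lambda2 A = nth 0 (sort >=%R (eigenvalues A)) 1.
    rewrite /lambda2 [in RHS]sorted_sort //.
    - by move=> x y z yx zy; exact: le_trans yx.
    - by apply: sort_sorted => x y; exact: le_total.
  rewrite sorted_nth1_le //; have /seq.permP -> := eig_perm.
  rewrite count_map cardE -size_filter; congr (size _ <= _)%N.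
  by rewrite /enum_mem -filter_predI; apply: eq_filter => i; rewrite !inE andbT.
have neq1 i : d 0 i != 1 -> eps 0 i = 0.
  move=> di; apply/eqP; have /eqP := epsd i.
  rewrite -[X in _ == X]mul1r -subr_eq0 -mulrBl mulf_eq0 subr_eq0.
  by rewrite -(rmorph1 toC) (inj_eq (@complexI R)) (negPf di).
rewrite lamE; split => [/card_le1_eqP uniq_c v /(congr1 toC)|quad].
- have /rV0Pn[i0 i00] := eps0.
  (* An index in the support of [eps] has eigenvalue 1 > c, so it is the only one above c. Hence
     [eps] is supported at [i0] alone, and orthogonality to e kills the coordinate [i0] of v. *)
  have d1 : d 0 i0 = 1 by apply/eqP; apply: contraNT i00 => /neq1 ->.
  have dle i : i != i0 -> d 0 i <= c.
    rewrite leNgt; apply: contra => ci; apply/eqP; apply: uniq_c => //.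
    by rewrite inE d1.
  rewrite dotE rmorph0 (bigD1 i0) //= big1 ?addr0 => [/eqP|i ii0]; last first.
    by rewrite neq1 ?conjC0 ?mulr0 // lt_eqF // (le_lt_trans (dle _ ii0)).
  rewrite mulf_eq0 conjC_eq0 (negPf i00) orbF => /eqP v0.
  rewrite -lecR rmorphM /= -quad_real -norm_real (coord_quad UU UU' AU) (coord_norm UU UU').
  rewrite mulr_sumr; apply: ler_sum => i _.
  have [->|/dle di] := eqVneq i i0; first by rewrite v0 normr0 expr0n !mulr0.
  by rewrite ler_wpM2r ?exprn_ge0 // lecR.
- rewrite leqNgt; apply/negP => /card_gt1P[i [j [/= ci cj ij]]].
  (* Coefficients of a nonzero combination of the eigenvectors i and j that is orthogonal to e. *)
  have [a [b [ab0 abe]]] : exists a b : C,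
      (a != 0) || (b != 0) /\ a * (eps 0 i)^* + b * (eps 0 j)^* = 0.
    have [ei|ei] := eqVneq (eps 0 i) 0.
      by exists 1, 0; rewrite oner_eq0 ei conjC0 mulr0 mul0r addr0.
    exists (- (eps 0 j)^*), ((eps 0 i)^*); split; last by rewrite mulNr mulrC addNr.
    by rewrite conjC_eq0 ei orbT.
  pose k : 'rV[C]_n := \row_l (if l == i then a else if l == j then b else 0).
  have sumk (F : 'I_n -> C -> C) : (forall l, F l 0 = 0) ->
      \sum_l F l (k 0 l) = F i a + F j b.
    move=> F0; rewrite (bigD1 i) //= (bigD1 j) 1?eq_sym //= big1 ?addr0.
      by rewrite !mxE eqxx [j == i]eq_sym (negPf ij) eqxx.
    by move=> l /andP[/negPf li /negPf lj]; rewrite mxE li lj F0.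
  have [x [y zxy]] := complex_row_split (k *m U).
  have kU := coord_mulmx UU k.
  have : ((x^C + 'i *: y^C) *m (e^C)^t*) 0 0 = 0.
    by rewrite -zxy (coord_dot UU UU') kU (sumk (fun l u => u * (eps 0 l)^*)) // => l;
      rewrite mul0r.
  rewrite map_row_adjoint mulmxDl -scalemxAl -!map_mxM.
  move: (x *m e^T) (y *m e^T) (quad x) (quad y) => xe ye qx0 qy0.
  rewrite !mxE => xye.
  (* Since e is real, the real and imaginary parts x and y are each orthogonal to e, so the real
     hypothesis applies to both. *)
  have [/qx0 qx /qy0 qy] : xe 0 0 = 0 /\ ye 0 0 = 0.
    move: xye; change ('i : C) with (0 +i* 1 : C)%C => xye.
    move/eqP: xye; rewrite eq_complex /= !(mul0r, mul1r, mulr0, subr0, addr0, add0r).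
    by case/andP => /eqP-> /eqP->.
  have := lerD qx qy; rewrite -mulrDr -lecR rmorphM /=.
  rewrite -(quad_complex symA) -norm_complex -zxy.
  rewrite (coord_quad UU UU' AU) (coord_norm UU UU') kU.
  rewrite (sumk (fun l u => toC (d 0 l) * `|u| ^+ 2)); last first.
    by move=> l; rewrite normr0 expr0n mulr0.
  rewrite (sumk (fun l u => `|u| ^+ 2)); last by move=> l; rewrite normr0 expr0n.
  rewrite mulrDr lt_geF //.
  have lt_part (u : C) l : c < d 0 l -> u != 0 ->
      toC c * `|u| ^+ 2 < toC (d 0 l) * `|u| ^+ 2.
    by move=> cl u0; rewrite ltr_pM2r ?ltcR // exprn_gt0 // normr_gt0.
  have le_part (u : C) l : c < d 0 l -> toC c * `|u| ^+ 2 <= toC (d 0 l) * `|u| ^+ 2.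
    by move=> cl; rewrite ler_wpM2r ?lecR ?exprn_ge0 // ltW.
  by case/orP: ab0 => [a0|b0]; [apply: ltr_leD | apply: ler_ltD];
    rewrite ?lt_part ?le_part.
Qed.

(** * Reversible walks and their symmetrised matrices *)

Section WeightedForms.
Variables (n : nat) (q : 'I_n -> R) (N : 'I_n -> 'I_n -> R).
Hypothesis q_ge0 : forall i, 0 <= q i.
Hypothesis N_sym : forall i j, N i j = N j i.
Hypothesis N_supp : forall i j, q i = 0 -> N i j = 0.

(** With D the diagonal matrix of q, S is the symmetrisation of N by the inverse square root of D,
    and [row_of] is the matching change of variables. Points with q = 0 are allowed: division by 0
    gives 0, which is consistent with [N_supp]. *)
Let r i := Num.sqrt (q i).
Let S : 'M[R]_n := \matrix_(i, j) (N i j / (r i * r j)).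
Let row_of (f : 'I_n -> R) : 'rV[R]_n := \row_i (r i * f i).

Let rr i : r i * r i = q i. Proof. by rewrite -expr2 sqr_sqrtr. Qed.
Let r0 i : r i = 0 -> q i = 0. Proof. by rewrite -rr => ->; rewrite mul0r. Qed.

Lemma weighted_sym : S^T = S.
Proof. by apply/matrixP => i j; rewrite !mxE N_sym mulrC [r j * _]mulrC mulrC. Qed.

Let NK i j : r i * (N i j / (r i * r j)) * r j = N i j.
Proof.
have [/r0 qi|ri] := eqVneq (r i) 0; first by rewrite N_supp // mul0r mulr0 mul0r.
have [/r0 qj|rj] := eqVneq (r j) 0; first by rewrite N_sym N_supp // mul0r mulr0 mul0r.
by field; rewrite ri rj.
Qed.

Lemma weighted_quad f :
  (row_of f *m S *m (row_of f)^T) 0 0 = \sum_i \sum_j N i j * f i * f j.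
Proof.
rewrite mxE exchange_big; apply: eq_bigr => j _; rewrite !mxE mulr_suml.
by apply: eq_bigr => i _; rewrite !mxE -[in RHS](NK i j); ring.
Qed.

Lemma weighted_norm f :
  (row_of f *m (row_of f)^T) 0 0 = \sum_i q i * f i ^+ 2.
Proof. by rewrite mxE; apply: eq_bigr => i _; rewrite !mxE -rr; ring. Qed.

(** An eigenvector v of S with eigenvalue s > c becomes the generalised eigenfunction v / r of the
    pair (N, q). The functions obtained are determined only where q is nonzero, hence the form
    [q i * f i = 0] of the hypothesis. *)
Lemma weighted_eigen_bound (c : R) : 0 <= c ->
  (forall s f, c < s -> (forall i, \sum_j N i j * f j = s * (q i * f i)) ->
     forall i, q i * f i = 0) ->
  forall f, \sum_i \sum_j N i j * f i * f j <= c * \sum_i q i * f i ^+ 2.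
Proof.
move=> c0 eig f; rewrite -weighted_quad -weighted_norm.
apply: (quad_le_eigen weighted_sym) => s v cs vS.
have s0 : s != 0 by rewrite gt_eqF // (le_lt_trans c0).
have vr i : r i = 0 -> v 0 i = 0.
  move=> ri; have /rowP/(_ i) := vS; rewrite !mxE big1 => [/esym/eqP|j _].
    by rewrite mulf_eq0 (negPf s0) => /eqP.
  by rewrite mxE ri mulr0 invr0 !mulr0.
have vE i : v 0 i = r i * (v 0 i / r i).
  have [ri|ri] := eqVneq (r i) 0; first by rewrite ri mul0r vr.
  by field.
have {}eig := eig s (fun i => v 0 i / r i) cs _.
apply/rowP => i; rewrite mxE vE.
have [->|ri] := eqVneq (r i) 0; first by rewrite mul0r.
apply: (mulfI ri); rewrite mulr0 mulrA rr; apply: eig => {i ri} i.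
rewrite -rr -!mulrA -vE mulrCA.
have /rowP/(_ i) := vS; rewrite !mxE => <-; rewrite mulr_sumr.
by apply: eq_bigr => j _; rewrite N_sym -[in LHS](NK j i) [in RHS]vE mxE; ring.
Qed.

Hypothesis q_gt0 : forall i, 0 < q i.
Hypothesis N_row : forall i, \sum_j N i j = q i.

(** The walk matrix is conjugate to S by the square root of D, and the constant function 1
    corresponds to the eigenvector of S with eigenvalue 1. *)
Lemma lambda2_walkP (c : R) : (0 < n)%N -> 0 <= c < 1 ->
  lambda2 (\matrix_(i, j) (N i j / q i)) <= c <->
  forall f : 'I_n -> R, \sum_i q i * f i = 0 ->
    \sum_i \sum_j N i j * f i * f j <= c * \sum_i q i * f i ^+ 2.
Proof.
move=> n0 c01.
have rgt i : r i != 0 by rewrite gt_eqF // sqrtr_gt0.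
pose Dm : 'M[R]_n := diag_mx (\row_i r i); pose Dv : 'M[R]_n := diag_mx (\row_i (r i)^-1).
have DvD : Dv *m Dm = 1%:M.
  apply/matrixP => i j; rewrite mul_diag_mx !mxE.
  by case: eqP => [->|]; rewrite ?mulr0 // mulr1n mulVf.
have SE : \matrix_(i, j) (N i j / q i) = Dv *m S *m Dm.
  apply/matrixP => i j; rewrite mul_mx_diag mxE [RHS]mxE mul_diag_mx !mxE -rr.
  by field; rewrite !rgt.
have -> : lambda2 (\matrix_(i, j) (N i j / q i)) = lambda2 S.
  by rewrite /lambda2 /eigenvalues SE char_poly_conj.
have e0 : row_of (fun=> 1) != 0.
  by apply/rV0Pn; exists (Ordinal n0); rewrite mxE mulr1.
have eS : row_of (fun=> 1) *m S = row_of (fun=> 1).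
  apply/rowP => j; rewrite !mxE mulr1; apply: (mulIf (rgt j)); rewrite rr mulr_suml.
  by rewrite -N_row; apply: eq_bigr => i _; rewrite !mxE mulr1 NK N_sym.
have dotE f : (row_of f *m (row_of (fun=> 1))^T) 0 0 = \sum_i q i * f i.
  by rewrite mxE; apply: eq_bigr => i _; rewrite !mxE -rr; ring.
rewrite (lambda2_quadP weighted_sym e0 eS c01); split => H.
  by move=> f f0; rewrite -weighted_quad -weighted_norm H // dotE.
move=> v; have -> : v = row_of (fun i => v 0 i / r i).
  by apply/rowP => i; rewrite mxE; field.
by rewrite dotE weighted_quad weighted_norm; apply: H.
Qed.

End WeightedForms.

Lemma finite_eigen_bound (U : finType) (q : U -> R) (N : U -> U -> R) (c : R) :
  (forall x, 0 <= q x) -> (forall x y, N x y = N y x) ->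
  (forall x y, q x = 0 -> N x y = 0) -> 0 <= c ->
  (forall s f, c < s -> (forall x, \sum_y N x y * f y = s * (q x * f x)) ->
     forall x, q x * f x = 0) ->
  forall f, \sum_x \sum_y N x y * f x * f y <= c * \sum_x q x * f x ^+ 2.
Proof.
move=> q0 Ns N0 c0 eig f.
have sumE (F : U -> R) : \sum_x F x = \sum_(i < #|U|) F (enum_val i).
  by rewrite -(big_enum_val F); apply: eq_bigl.
rewrite !sumE; under eq_bigr do rewrite sumE.
apply: (@weighted_eigen_bound _ (fun i => q (enum_val i))
  (fun i j => N (enum_val i) (enum_val j)) _ _ _ c c0 _ (fun i => f (enum_val i))).
- by [].
- by move=> i j; apply: Ns.
- by move=> i j; apply: N0.
move=> s g cs gE i.
have := eig s (fun x => g (enum_rank x)) cs _ (enum_val i); rewrite enum_valK; apply.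
move=> x; have := gE (enum_rank x); rewrite enum_rankK => <-.
by rewrite sumE; apply: eq_bigr => j _; rewrite enum_valK.
Qed.

End Spectral.

(** * Covariance, conditional expectation and maximal correlation for a finite weight *)

Section Covariance.
Variables (R : rcfType) (O U : finType).
Implicit Types (w F G : O -> R) (X Y Z : O -> U) (f g : U -> R) (c : R).

Definition wsum w F : R := \sum_s w s * F s.

(** This is the usual covariance multiplied by the total mass, because w need not have mass 1. With
    this scaling the covariances under the restrictions [restr w Z z] add up over z without
    factors. *)
Definition cov w F G : R :=
  wsum w (fun s => F s * G s) - wsum w F * wsum w G / wsum w (fun=> 1).

Definition restr w Z z : O -> R := fun s => if Z s == z then w s else 0.

(* Equal to 0 when [Z = z] has weight 0. *)
Definition cexp w Z F z : R := wsum (restr w Z z) F / wsum (restr w Z z) (fun=> 1).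

(* For [c >= 0], scaling [f] and [g] turns this into
   [cov (f X) (g Y) ^+ 2 <= c * var (f X) * var (g Y)]; the linear form can be
   summed over the values of a conditioning variable. *)
Definition corr_le w X Y c : Prop := forall f g,
  2 * cov w (f \o X) (g \o Y)
    <= c * cov w (f \o X) (f \o X) + cov w (g \o Y) (g \o Y).

Lemma eq_wsum w F G : F =1 G -> wsum w F = wsum w G.
Proof. by move=> FG; apply: eq_bigr => s _; rewrite FG. Qed.

Lemma wsumD w F G : wsum w (fun s => F s + G s) = wsum w F + wsum w G.
Proof. by rewrite /wsum -big_split; apply: eq_bigr => s _; rewrite mulrDr. Qed.

Lemma wsumZ w c F : wsum w (fun s => c * F s) = c * wsum w F.
Proof. by rewrite /wsum mulr_sumr; apply: eq_bigr => s _; rewrite mulrCA. Qed.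

Lemma wsum_sum w (I : finType) (F : I -> O -> R) :
  wsum w (fun s => \sum_i F i s) = \sum_i wsum w (F i).
Proof.
by rewrite /wsum exchange_big; apply: eq_bigr => s _; rewrite mulr_sumr.
Qed.

Lemma covC w F G : cov w F G = cov w G F.
Proof.
rewrite /cov [wsum w F * _]mulrC; congr (_ - _).
by apply: eq_wsum => s; rewrite mulrC.
Qed.

Lemma covZl w a F G : cov w (fun s => a * F s) G = a * cov w F G.
Proof.
have E : wsum w (fun s => a * F s * G s) = a * wsum w (fun s => F s * G s).
  by rewrite -wsumZ; apply: eq_wsum => s; rewrite mulrA.
by rewrite /cov E wsumZ; ring.
Qed.

Lemma covZr w a F G : cov w F (fun s => a * G s) = a * cov w F G.
Proof. by rewrite covC covZl covC. Qed.

Lemma cov_suml w (I : finType) (P : pred I) (F : I -> O -> R) G :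
  cov w (fun s => \sum_(i | P i) F i s) G = \sum_(i | P i) cov w (F i) G.
Proof.
have sumP H : wsum w (fun s => \sum_(i | P i) H i s) = \sum_(i | P i) wsum w (H i).
  by rewrite /wsum exchange_big; apply: eq_bigr => s _; rewrite mulr_sumr.
rewrite /cov sumrB sumP !mulr_suml; congr (_ - _).
by rewrite -sumP; apply: eq_wsum => s; rewrite mulr_suml.
Qed.

Lemma cov_sumr w (I : finType) (P : pred I) (F : I -> O -> R) G :
  cov w G (fun s => \sum_(i | P i) F i s) = \sum_(i | P i) cov w G (F i).
Proof. by rewrite covC cov_suml; apply: eq_bigr => i _; rewrite covC. Qed.

Lemma restr_ge0 w Z z : (forall s, 0 <= w s) -> forall s, 0 <= restr w Z z s.
Proof. by move=> w0 s; rewrite /restr; case: ifP. Qed.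

Lemma wsum_restr w Z z F : wsum (restr w Z z) F = \sum_(s | Z s == z) w s * F s.
Proof.
by rewrite [RHS]big_mkcond; apply: eq_bigr => s _; rewrite /restr; case: ifP; rewrite ?mul0r.
Qed.

Lemma wsum_partition w Z F : wsum w F = \sum_z wsum (restr w Z z) F.
Proof.
rewrite {1}/wsum (partition_big Z xpredT) //=.
by apply: eq_bigr => z _; rewrite -wsum_restr.
Qed.

Lemma wsum_comp w Z (k : U -> R) F :
  wsum w (fun s => k (Z s) * F s) = \sum_z k z * wsum (restr w Z z) F.
Proof.
rewrite (wsum_partition _ Z); apply: eq_bigr => z _; rewrite !wsum_restr mulr_sumr.
by apply: eq_bigr => s /eqP ->; rewrite mulrCA.
Qed.

Lemma wsum0 w F : (forall s, 0 <= w s) -> wsum w (fun=> 1) = 0 -> wsum w F = 0.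
Proof.
move=> w0 /eqP; rewrite psumr_eq0 => [/allP w1|s _]; last by rewrite mulr1.
apply: big1 => s _; have := w1 s (mem_index_enum _); rewrite mulr1 /= => /eqP ->.
by rewrite mul0r.
Qed.

Lemma wsum_ge0 w F : (forall s, 0 <= w s) -> (forall s, 0 <= F s) -> 0 <= wsum w F.
Proof. by move=> w0 F0; apply: sumr_ge0 => s _; rewrite mulr_ge0. Qed.

Lemma wsum_sqr_eq0 w F : (forall s, 0 <= w s) ->
  wsum w (fun s => F s ^+ 2) = 0 -> forall s, w s != 0 -> F s = 0.
Proof.
move=> w0 /eqP; rewrite psumr_eq0 => [/allP w1 s ws|s _]; last by rewrite mulr_ge0 ?sqr_ge0.
have := w1 s (mem_index_enum _).
by rewrite mulf_eq0 (negPf ws) expf_eq0 /= => /eqP.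
Qed.

Section NonnegativeWeight.
Variable w : O -> R.
Hypothesis w_ge0 : forall s, 0 <= w s.

Let mean F := wsum w F / wsum w (fun=> 1).

Lemma meanK F : mean F * wsum w (fun=> 1) = wsum w F.
Proof.
rewrite /mean; have [m0|m0] := eqVneq (wsum w (fun=> 1)) 0.
  by rewrite m0 mulr0 wsum0.
by rewrite divfK.
Qed.

Lemma wsum_center F : wsum w (fun s => F s - mean F) = 0.
Proof.
rewrite wsumD; have -> : wsum w (fun=> - mean F) = - mean F * wsum w (fun=> 1).
  by rewrite -wsumZ; apply: eq_wsum => s; rewrite mulr1.
by rewrite mulNr meanK subrr.
Qed.

Lemma cov_centered F G : wsum w F = 0 -> cov w F G = wsum w (fun s => F s * G s).
Proof. by move=> F0; rewrite /cov F0 mul0r mul0r subr0. Qed.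

Lemma cov_shiftl F G a : cov w (fun s => F s - a) G = cov w F G.
Proof.
rewrite /cov.
have -> : wsum w (fun s => (F s - a) * G s) = wsum w (fun s => F s * G s) - a * wsum w G.
  by rewrite -mulNr -wsumZ -wsumD; apply: eq_wsum => s; ring.
have -> : wsum w (fun s => F s - a) = wsum w F - a * wsum w (fun=> 1).
  by rewrite wsumD -mulNr -wsumZ; congr (_ + _); apply: eq_wsum => s; rewrite mulr1.
rewrite -[wsum w G]meanK; have [->|m0] := eqVneq (wsum w (fun=> 1)) 0; first by ring.
by field.
Qed.

Lemma cov_shiftr F G a : cov w F (fun s => G s - a) = cov w F G.
Proof. by rewrite covC cov_shiftl covC. Qed.

Lemma cov_ge0 F : 0 <= cov w F F.
Proof.
rewrite -(cov_shiftl _ _ (mean F)) -(cov_shiftr _ _ (mean F)).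
rewrite cov_centered ?wsum_center //; apply: wsum_ge0 => // s.
by rewrite -expr2 sqr_ge0.
Qed.

Lemma cov_le_wsum F : cov w F F <= wsum w (fun s => F s ^+ 2).
Proof.
rewrite /cov lerBlDr lerDl -expr2 divr_ge0 ?sqr_ge0 //.
by apply: wsum_ge0 => // s; apply: ler01.
Qed.

Lemma wsum_cexp Z F (k : U -> R) :
  wsum w (fun s => k (Z s) * cexp w Z F (Z s)) = wsum w (fun s => k (Z s) * F s).
Proof.
rewrite [RHS](wsum_comp w Z k).
have -> : wsum w (fun s => k (Z s) * cexp w Z F (Z s))
    = \sum_z (k z * cexp w Z F z) * wsum (restr w Z z) (fun=> 1).
  rewrite -(wsum_comp w Z (fun z => k z * cexp w Z F z)).
  by apply: eq_wsum => s; rewrite mulr1.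
apply: eq_bigr => z _; rewrite -mulrA; congr (_ * _).
rewrite /cexp; have [m0|m0] := eqVneq (wsum (restr w Z z) (fun=> 1)) 0.
  by rewrite m0 mulr0 wsum0 //; apply: restr_ge0.
by rewrite divfK.
Qed.

(** Law of total covariance: what the conditional covariances miss is the part explained by Z. *)
Lemma total_cov Z F G :
  \sum_z cov (restr w Z z) F G = wsum w (fun s => F s * G s)
    - wsum w (fun s => cexp w Z F (Z s) * cexp w Z G (Z s)).
Proof.
rewrite sumrB -wsum_partition (wsum_cexp _ _ (cexp w Z F)).
rewrite (wsum_comp _ _ (cexp w Z F)); congr (_ - _).
by apply: eq_bigr => z _; rewrite /cexp mulrAC.
Qed.

(** Scaling f by t makes the left side of [corr_le] grow linearly, while for c = 0 the right side
    does not move. So [corr_le] with constant 0 expresses independence. *)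
Lemma corr_le_indep X Y f g : corr_le w X Y 0 -> cov w (f \o X) (g \o Y) = 0.
Proof.
move=> XY; apply/eqP; apply: contraT => C0.
pose t := (cov w (g \o Y) (g \o Y) + 1) / (2 * cov w (f \o X) (g \o Y)).
have := XY (fun x => t * f x) g; rewrite covZl mul0r add0r.
have -> : 2 * (t * cov w (f \o X) (g \o Y)) = cov w (g \o Y) (g \o Y) + 1.
  by rewrite /t; field.
by rewrite gerDl ler10.
Qed.

Lemma corr_le_mono X Y c c' : c <= c' -> corr_le w X Y c -> corr_le w X Y c'.
Proof.
move=> cc XY f g; apply: le_trans (XY f g) _.
by rewrite lerD2r ler_wpM2r ?cov_ge0.
Qed.

(** Apply the bound to f / v and multiply by v. Any split u v = c of the constant between the two
    variances is thus available. *)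
Lemma corr_le_balanced X Y c u v : corr_le w X Y c -> 0 < v -> u * v = c ->
  forall f g, 2 * cov w (f \o X) (g \o Y)
    <= u * cov w (f \o X) (f \o X) + v * cov w (g \o Y) (g \o Y).
Proof.
move=> XY v0 uv f g; have := XY (fun x => v^-1 * f x) g.
rewrite !covZl !covZr -uv -[fun s => f (X s)]/(f \o X) -subr_ge0 => H.
rewrite -subr_ge0; apply: le_trans (mulr_ge0 (ltW v0) H) _; rewrite le_eqVlt.
by apply/orP; left; apply/eqP; field; rewrite gt_eqF.
Qed.

Lemma corr_le_sym X Y c : 0 <= c -> corr_le w X Y c -> corr_le w Y X c.
Proof.
rewrite le_eqVlt => /orP[/eqP <-|c0] XY g f; rewrite covC.
  (* The case c = 0 is separate because the balanced form, used next with u = 1 and v = c, requires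
     v > 0. *)
  by rewrite corr_le_indep // mulr0 mul0r add0r cov_ge0.
by rewrite addrC -[cov w (f \o X) (f \o X)]mul1r (corr_le_balanced XY) // mul1r.
Qed.

Lemma wsum_cexp1 Y F : wsum w (cexp w Y F \o Y) = wsum w F.
Proof.
have := wsum_cexp Y F (fun=> 1).
by rewrite (eq_wsum _ (fun s => mul1r (cexp w Y F (Y s)))) (eq_wsum _ (fun s => mul1r (F s))).
Qed.

Lemma cov_cexp Y F k : cov w F (k \o Y) = cov w (cexp w Y F \o Y) (k \o Y).
Proof.
rewrite /cov wsum_cexp1; congr (_ - _).
rewrite (eq_wsum _ (fun s => mulrC (F s) ((k \o Y) s))).
by rewrite (eq_wsum _ (fun s => mulrC ((cexp w Y F \o Y) s) ((k \o Y) s))) wsum_cexp.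
Qed.

End NonnegativeWeight.

(** * Three-variable chains: composition of correlations and the trickling-down bound *)

Section Trickle.
Variable w : O -> R.
Hypothesis w_ge0 : forall s, 0 <= w s.

Lemma wsum_markov X Y Z f k : (forall y, corr_le (restr w Y y) X Z 0) ->
  wsum w (fun s => f (X s) * k (Z s))
    = wsum w (fun s => cexp w Y (f \o X) (Y s) * k (Z s)).
Proof.
move=> indep; apply/eqP; rewrite -subr_eq0.
rewrite -(wsum_cexp w_ge0 Y (k \o Z) (cexp w Y (f \o X))).
rewrite -(total_cov w_ge0 Y (f \o X) (k \o Z)) big1 // => y _.
by apply: corr_le_indep; apply: indep.
Qed.

(** By the Markov property f(X) may be replaced by h(Y) with h = E[f|Y]. The bound for X and Y,
    tested on f and h, gives Var h <= c1 Var f, because Cov(f, h) = Var h. *)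
Lemma corr_le_compose X Y Z c1 c2 : 0 <= c2 ->
  (forall y, corr_le (restr w Y y) X Z 0) ->
  corr_le w X Y c1 -> corr_le w Y Z c2 -> corr_le w X Z (c1 * c2).
Proof.
move=> c20 indep XY YZ f g; pose h := cexp w Y (f \o X).
have -> : cov w (f \o X) (g \o Z) = cov w (h \o Y) (g \o Z).
  by rewrite /cov wsum_cexp1 // (wsum_markov f g indep).
apply: le_trans (YZ h g) _; rewrite lerD2r [c1 * _]mulrC -mulrA ler_wpM2l //.
have := XY f h; rewrite cov_cexp // -/h; lra.
Qed.

(** Discriminant of a quadratic in t, evaluated at its minimiser t = x / a. If a = 0, an affine
    function bounded below is constant, so x = 0. *)
Lemma le_of_discr (x a b : R) : 0 <= a ->
  (forall t, 2 * (t * x) <= t ^+ 2 * a + b) -> x ^+ 2 <= a * b.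
Proof.
rewrite le_eqVlt => /orP[/eqP <-|a0] H.
  have [->|x0] := eqVneq x 0; first by rewrite expr0n mul0r.
  by have := H ((b + 1) / x); rewrite divfK //; have := H 0; nra.
have := H (x / a).
have -> : 2 * (x / a * x) = 2 * (x ^+ 2 / a) by rewrite mulrAC.
have -> : (x / a) ^+ 2 * a = x ^+ 2 / a by field; rewrite gt_eqF.
by move=> ?; rewrite mulrC -ler_pdivrMr //; lra.
Qed.

Lemma wsum_sqB F G : wsum w (fun o => (F o - G o) ^+ 2)
  = wsum w (fun o => F o ^+ 2) - 2 * wsum w (fun o => F o * G o) + wsum w (fun o => G o ^+ 2).
Proof.
rewrite -mulNr -wsumZ -!wsumD; apply: eq_wsum => o; ring.
Qed.

(** The conditional bounds are summed over the values of Z by [total_cov]. The factor t is left free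
    so that [le_of_discr] can turn the linear form into a product form. *)
Lemma cond_corr_le Z X Y c f g t : (forall z, corr_le (restr w Z z) X Y c) ->
  2 * (t * (wsum w (fun o => f (X o) * g (Y o))
            - wsum w (fun o => cexp w Z (f \o X) (Z o) * cexp w Z (g \o Y) (Z o))))
  <= t ^+ 2 * (c * (wsum w (fun o => f (X o) ^+ 2)
                    - wsum w (fun o => cexp w Z (f \o X) (Z o) ^+ 2)))
     + (wsum w (fun o => g (Y o) ^+ 2) - wsum w (fun o => cexp w Z (g \o Y) (Z o) ^+ 2)).
Proof.
move=> H; have tc := total_cov w_ge0 Z.
rewrite -(tc (f \o X) (g \o Y)) -(tc (f \o X) (f \o X)) -(tc (g \o Y) (g \o Y)).
rewrite !mulr_sumr -big_split; apply: ler_sum => z _ /=.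
have := H z (fun u => t * f u) g; rewrite !covZl !covZr -[fun s => f (X s)]/(f \o X); lra.
Qed.

Section EigenFunction.
Variables (X Y Z : O -> U) (al be s : R) (f : U -> R).
Hypothesis al_ge0 : 0 <= al.
Hypothesis be_ge0 : 0 <= be.
Hypothesis XYZ : forall z, corr_le (restr w Z z) X Y al.
Hypothesis YZX : forall x, corr_le (restr w X x) Y Z be.
Hypothesis XZY : forall y, corr_le (restr w Y y) X Z 0.
Hypothesis s_gt0 : 0 < s.

Let phi := f \o X.
Let g := cexp w Y phi.
Let gam := g \o Y.
Let h := cexp w Z gam.
Let eta := h \o Z.
Let A := wsum w (fun o => phi o ^+ 2).
Let B := wsum w (fun o => eta o ^+ 2).
(** Weak form of E[gam|X] = s phi, that is, phi is an eigenfunction of the walk X -> Y -> X. *)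
Hypothesis gamX : forall k,
  wsum w (fun o => k (X o) * gam o) = s * wsum w (fun o => k (X o) * phi o).

Let gamY k : wsum w (fun o => k (Y o) * gam o) = wsum w (fun o => k (Y o) * phi o).
Proof. exact: wsum_cexp. Qed.

Let etaZ k : wsum w (fun o => k (Z o) * eta o) = wsum w (fun o => k (Z o) * gam o).
Proof. exact: wsum_cexp. Qed.

Let phiZ k : wsum w (fun o => k (Z o) * phi o) = wsum w (fun o => k (Z o) * gam o).
Proof.
rewrite (eq_wsum _ (fun o => mulrC (k (Z o)) (phi o))) (wsum_markov f k XZY).
by apply: eq_wsum => o; rewrite mulrC.
Qed.

Let phi2 : wsum w (fun o => phi o * gam o) = s * A.
Proof. by rewrite (gamX f). Qed.

Let gam2 : wsum w (fun o => gam o ^+ 2) = s * A.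
Proof.
rewrite -phi2; have := gamY g; rewrite -/gam => H.
by rewrite (eq_wsum _ (fun o => mulrC (phi o) (gam o))) -[RHS]H.
Qed.

Let etagam : wsum w (fun o => eta o * gam o) = B.
Proof. by rewrite -(etaZ h). Qed.

Let etaphi : wsum w (fun o => eta o * phi o) = B.
Proof. by rewrite -etagam -(phiZ h). Qed.

Let sq_ge0 F : 0 <= wsum w (fun o => F o ^+ 2).
Proof. by apply: wsum_ge0 => // o; apply: sqr_ge0. Qed.

Let A_ge0 : 0 <= A. Proof. exact: sq_ge0. Qed.

Let s_le1 : s * A <= A.
Proof. have := sq_ge0 (fun o => phi o - gam o); rewrite wsum_sqB phi2 gam2 -/A; lra. Qed.

Let B_ge0 : 0 <= B. Proof. exact: sq_ge0. Qed.

Let B_le : B <= s * A.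
Proof. have := sq_ge0 (fun o => eta o - gam o); rewrite wsum_sqB etagam gam2 -/B; lra. Qed.

(** By the Markov property phi and gam have the same conditional expectation given Z; testing
    against indicators of values of Z makes this pointwise. *)
Let cexpZphi : cexp w Z phi =1 h.
Proof.
move=> z; congr (_ / _).
have := phiZ (fun u => (u == z)%:R).
have indE F : wsum w (fun o => (Z o == z)%:R * F o) = wsum (restr w Z z) F.
  rewrite wsum_restr [RHS]big_mkcond; apply: eq_bigr => o _.
  by case: ifP; rewrite ?mul1r // mul0r mulr0.
by rewrite !indE.
Qed.

Let cexpXgam o : w o != 0 -> cexp w X gam (X o) = s * phi o.
Proof.
move=> wo; set x := X o.
have indE F : wsum w (fun o => (X o == x)%:R * F o) = wsum (restr w X x) F.
  rewrite wsum_restr [RHS]big_mkcond; apply: eq_bigr => o' _.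
  by case: ifP; rewrite ?mul1r // mul0r mulr0.
have := gamX (fun u => (u == x)%:R); rewrite !indE /cexp => ->.
have -> : wsum (restr w X x) phi = f x * wsum (restr w X x) (fun=> 1).
  by rewrite !wsum_restr mulr_sumr; apply: eq_bigr => o' /eqP; rewrite /phi /= => ->; ring.
rewrite mulrA mulfK //; rewrite gt_eqF // wsum_restr.
rewrite (bigD1 o) //= mulr1 ltr_pwDl // ?lt_neqAle 1?eq_sym ?wo ?w_ge0 //.
by apply: sumr_ge0 => o' _; rewrite mulr1.
Qed.

(** Given Z, the total covariance of phi and gam is sA - B, and their total variances are A - B and
    sA - B. One factor sA - B cancels from the discriminant inequality. *)
Let cond_Z : s * A - B <= al * (A - B).
Proof.
have disc t : 2 * (t * (s * A - B)) <= t ^+ 2 * (al * (A - B)) + (s * A - B).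
  have := cond_corr_le f g t XYZ.
  rewrite -[wsum w (fun o => f (X o) * g (Y o))]/(wsum w (fun o => phi o * gam o)) phi2.
  rewrite -[wsum w (fun o => f (X o) ^+ 2)]/A.
  rewrite -[wsum w (fun o => g (Y o) ^+ 2)]/(wsum w (fun o => gam o ^+ 2)) gam2.
  rewrite -[wsum w (fun o => cexp w Z (g \o Y) (Z o) ^+ 2)]/B.
  have -> : wsum w (fun o => cexp w Z (f \o X) (Z o) * cexp w Z (g \o Y) (Z o)) = B.
    by apply: eq_wsum => o; rewrite cexpZphi -expr2.
  have -> : wsum w (fun o => cexp w Z (f \o X) (Z o) ^+ 2) = B.
    by apply: eq_wsum => o; rewrite cexpZphi.
  by [].
have AB : 0 <= A - B by have := B_le; have := s_le1; lra.
have := le_of_discr (mulr_ge0 al_ge0 AB) disc; rewrite expr2.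
have [->|ne] := eqVneq (s * A) B; first by rewrite subrr mulr_ge0.
by rewrite ler_pM2r // subr_gt0 lt_neqAle eq_sym ne B_le.
Qed.

(** Given X, the total covariance of gam and eta is B(1 - s), and the total variances are sA(1 - s)
    and at most B - B^2/A. The factor B(1 - s) cancels from the discriminant inequality. *)
Let cond_X : s < 1 -> 0 < A -> B * (1 - s) <= be * s * (A - B).
Proof.
move=> s1 A0.
pose M := wsum w (fun o => cexp w X eta (X o) ^+ 2).
have cexpXgamE (F : R -> O -> R) : wsum w (fun o => F (cexp w X gam (X o)) o)
    = wsum w (fun o => F (s * phi o) o).
  apply: eq_bigr => o _; have [->|wo] := eqVneq (w o) 0; first by rewrite !mul0r.
  by rewrite cexpXgam.
have phieta : wsum w (fun o => phi o * cexp w X eta (X o)) = B.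
  rewrite -etaphi (wsum_cexp w_ge0 X eta f); apply: eq_wsum => o; exact: mulrC.
(* Cauchy-Schwarz: E[eta|X] has inner product B with phi, so its squared norm is at least that of
   its projection (B / A) phi. *)
have MB : B ^+ 2 / A <= M.
  have := sq_ge0 (fun o => cexp w X eta (X o) - B / A * phi o).
  rewrite wsum_sqB -/M.
  have -> : wsum w (fun o => cexp w X eta (X o) * (B / A * phi o)) = B ^+ 2 / A.
    transitivity (B / A * wsum w (fun o => phi o * cexp w X eta (X o))).
      by rewrite -wsumZ; apply: eq_wsum => o; ring.
    by rewrite phieta expr2 mulrAC.
  have -> : wsum w (fun o => (B / A * phi o) ^+ 2) = B ^+ 2 / A.
    rewrite (eq_wsum _ (fun o => exprMn 2 (B / A) (phi o))) wsumZ -/A.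
    by field; rewrite gt_eqF.
  lra.
have disc t : 2 * (t * (B * (1 - s))) <= t ^+ 2 * (be * (s * A * (1 - s))) + (B - B ^+ 2 / A).
  have := cond_corr_le g h t YZX.
  rewrite -[wsum w (fun o => g (Y o) * h (Z o))]/(wsum w (fun o => gam o * eta o)).
  rewrite (eq_wsum _ (fun o => mulrC (gam o) (eta o))) etagam.
  rewrite -[wsum w (fun o => g (Y o) ^+ 2)]/(wsum w (fun o => gam o ^+ 2)) gam2.
  rewrite -[wsum w (fun o => h (Z o) ^+ 2)]/B.
  rewrite -[wsum w (fun o => cexp w X (h \o Z) (X o) ^+ 2)]/M.
  rewrite (cexpXgamE (fun a o => a ^+ 2)) (cexpXgamE (fun a o => a * cexp w X (h \o Z) (X o))).
  rewrite (eq_wsum _ (fun o => exprMn 2 s (phi o))) wsumZ -/A.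
  rewrite (eq_wsum _ (fun o => esym (mulrA s (phi o) _))) wsumZ phieta.
  have -> : B - s * B = B * (1 - s) by ring.
  have -> : s * A - s ^+ 2 * A = s * A * (1 - s) by ring.
  move: MB; lra.
have s10 : 0 < 1 - s by rewrite subr_gt0.
have := le_of_discr _ disc.
have -> : be * (s * A * (1 - s)) * (B - B ^+ 2 / A) = (be * s * (A - B)) * (B * (1 - s)).
  by field; rewrite gt_eqF.
move=> /(_ _); rewrite expr2.
have [->|B0] := eqVneq B 0.
  by rewrite mul0r subr0 !mulr_ge0 // ltW.
rewrite ler_pM2r; first apply; rewrite ?mulr_ge0 ?(ltW s10) ?(ltW s_gt0) //.
by rewrite mulr_gt0 // lt_neqAle eq_sym B0.
Qed.

Lemma eigen_trickle : s * (1 - be) <= al \/ forall o, w o != 0 -> phi o = gam o.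
Proof.
have [A0|] := ltP 0 A; last first.
  move=> A0; right => o wo.
  have {}A0 : A = 0 by apply/eqP; rewrite eq_le A0 A_ge0.
  have -> : phi o = 0 by apply: (wsum_sqr_eq0 w_ge0 A0).
  by have := gam2; rewrite A0 mulr0 => /(wsum_sqr_eq0 w_ge0)/(_ o wo) ->.
have s1 : s <= 1 by rewrite -(ler_pM2r A0) mul1r.
move: s1; rewrite le_eqVlt => /orP[/eqP s1|s1]; [right | left].
  move=> o wo; apply/eqP; rewrite -subr_eq0; apply/eqP.
  apply: (wsum_sqr_eq0 (F := fun o => phi o - gam o) w_ge0 _ wo).
  by rewrite wsum_sqB phi2 gam2 -/A s1; ring.
(* The left sides of [cond_Z] and [cond_X] add up to s(A - B), so dividing by A - B > 0 leaves s <=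
   al + be s. *)
have AB : 0 < A - B by rewrite subr_gt0 (le_lt_trans B_le) // gtr_pMl.
have := cond_X s1 A0; have := cond_Z => h1 h2.
by rewrite -(ler_pM2r AB); lra.
Qed.

End EigenFunction.

(** The last hypothesis is connectivity: a quantity determined both by X and by Y is constant. It
    excludes the second alternative of [eigen_trickle] for mean-zero functions, so every nontrivial
    eigenvalue of X -> Y -> X is at most al / (1 - be), which bounds Var E[f|Y]. *)
Lemma corr_le_trickle X Y Z al be : 0 <= al -> 0 <= be < 1 ->
  (forall z, corr_le (restr w Z z) X Y al) ->
  (forall x, corr_le (restr w X x) Y Z be) ->
  (forall y, corr_le (restr w Y y) X Z 0) ->
  (forall f g, (forall o, w o != 0 -> f (X o) = g (Y o)) ->
     exists k, forall o, w o != 0 -> f (X o) = k) ->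
  corr_le w X Y (al / (1 - be)).
Proof.
move=> al0 /andP[be0 be1] XYZ YZX XZY conn.
set c := al / (1 - be); set m := wsum w (fun=> 1).
have be10 : 0 < 1 - be by rewrite subr_gt0.
have c0 : 0 <= c by rewrite divr_ge0 // ltW.
pose I x : O -> R := fun o => (X o == x)%:R.
pose q x := wsum w (I x).
(* Matrix of the form E[f|Y]^2 with the constants projected out, so that no eigenvalue 1 remains
   from the constant functions. *)
pose N x x' := wsum w (fun o => cexp w Y (I x) (Y o) * cexp w Y (I x') (Y o)) - q x * q x' / m.
have I_sum v f F : wsum v (fun o => f (X o) * F o) = \sum_x f x * wsum v (fun o => I x o * F o).
  rewrite wsum_comp; apply: eq_bigr => x _; congr (_ * _).
  rewrite wsum_restr big_mkcond; apply: eq_bigr => o _; rewrite /I.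
  by case: ifP; rewrite ?mul1r // mul0r mulr0.
have I_sum1 v f : wsum v (f \o X) = \sum_x f x * wsum v (I x).
  transitivity (wsum v (fun o => f (X o) * 1)); first by apply: eq_wsum => o; rewrite mulr1.
  rewrite (I_sum v f (fun=> 1)); apply: eq_bigr => x _; congr (_ * _).
  by apply: eq_wsum => o; rewrite mulr1.
have I_total v F : \sum_x wsum v (fun o => I x o * F o) = wsum v F.
  transitivity (wsum v (fun o => (fun=> 1) (X o) * F o)); last first.
    by apply: eq_wsum => o; rewrite mul1r.
  by rewrite (I_sum v (fun=> 1) F); apply: eq_bigr => x _; rewrite mul1r.
have q_total : \sum_x q x = m.
  by rewrite /m -(I_total w (fun=> 1)); apply: eq_bigr => x _; apply: eq_wsum => o; rewrite mulr1.
have cexp_lin f y : cexp w Y (f \o X) y = \sum_x f x * cexp w Y (I x) y.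
  by rewrite /cexp I_sum1 mulr_suml; apply: eq_bigr => x _; rewrite mulrA.
have N_form f x : \sum_x' N x x' * f x' =
    wsum w (fun o => I x o * cexp w Y (f \o X) (Y o)) - q x * wsum w (f \o X) / m.
  rewrite (eq_wsum _ (fun o => mulrC (I x o) _)) -(wsum_cexp w_ge0 Y (I x)).
  have -> : wsum w (fun o => cexp w Y (f \o X) (Y o) * cexp w Y (I x) (Y o))
     = \sum_x' wsum w (fun o => cexp w Y (I x) (Y o) * cexp w Y (I x') (Y o)) * f x'.
    under eq_bigr do rewrite mulrC -wsumZ.
    rewrite -wsum_sum; apply: eq_wsum => o; rewrite cexp_lin mulr_suml.
    by apply: eq_bigr => x' _; ring.
  rewrite I_sum1 mulr_sumr mulr_suml -sumrB; apply: eq_bigr => x' _.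
  by rewrite /N -/(q x'); ring.
have N_quad f : \sum_x \sum_x' N x x' * f x * f x' =
    wsum w (fun o => cexp w Y (f \o X) (Y o) ^+ 2) - wsum w (f \o X) ^+ 2 / m.
  transitivity (\sum_x f x * \sum_x' N x x' * f x').
    by apply: eq_bigr => x _; rewrite mulr_sumr; apply: eq_bigr => x' _; ring.
  under eq_bigr do rewrite N_form mulrBr.
  rewrite sumrB -I_sum; congr (_ - _).
    rewrite (eq_wsum _ (fun o => mulrC (f (X o)) _)).
    by rewrite -(wsum_cexp w_ge0 Y (f \o X)).
  by rewrite expr2 {2}I_sum1 !mulr_suml; apply: eq_bigr => x _; rewrite !mulrA.
have bound f : wsum w (fun o => cexp w Y (f \o X) (Y o) ^+ 2) - wsum w (f \o X) ^+ 2 / m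
    <= c * wsum w (fun o => f (X o) ^+ 2).
  rewrite -N_quad.
  have -> : wsum w (fun o => f (X o) ^+ 2) = \sum_x q x * f x ^+ 2.
    by rewrite (I_sum1 w (fun x => f x ^+ 2)); apply: eq_bigr => x _; rewrite mulrC.
  have I_ge0 x o : 0 <= I x o by apply: ler0n.
  apply: finite_eigen_bound => //.
  - by move=> x; apply: wsum_ge0.
  - move=> x x'; rewrite /N [q x * _]mulrC; congr (_ - _).
    by apply: eq_wsum => o; rewrite mulrC.
  - move=> x x' qx; rewrite /N qx !mul0r subr0.
    rewrite (eq_wsum _ (fun o => mulrC _ (cexp w Y (I x') (Y o)))) wsum_cexp //.
    move/eqP: qx; rewrite psumr_eq0 => [/allP qx|o _]; last exact: mulr_ge0.
    apply: big1 => o _; have /eqP := qx o (mem_index_enum _).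
    by rewrite mulrCA => ->; rewrite mulr0.
  move=> s {}f cs eig.
  have s0 : 0 < s by apply: le_lt_trans cs.
  (* The columns of N sum to 0, so summing the eigenvalue equation over x gives s times the total of
     f equal to 0. *)
  have f0 : wsum w (f \o X) = 0.
    have : \sum_x \sum_x' N x x' * f x' = s * wsum w (f \o X).
      rewrite I_sum1 mulr_sumr; apply: eq_bigr => x _; rewrite eig; congr (_ * _).
      by rewrite mulrC.
    under eq_bigr do rewrite N_form -mulrA.
    rewrite sumrB I_total -mulr_suml q_total wsum_cexp1 // [m * _]mulrC meanK // subrr.
    by move/esym/eqP; rewrite mulf_eq0 gt_eqF //= => /eqP.
  have gamX k : wsum w (fun o => k (X o) * (cexp w Y (f \o X) \o Y) o)
      = s * wsum w (fun o => k (X o) * (f \o X) o).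
    rewrite (I_sum w k) (I_sum1 w (fun x => k x * f x)) mulr_sumr.
    apply: eq_bigr => x _; have := N_form f x; rewrite eig f0 mulr0 mul0r subr0 => <-.
    by rewrite -/(q x); ring.
  (* The first alternative would give s <= c. The second makes f(X) constant on the support, and
     that constant is 0 because the total is 0. *)
  have [|fg] := eigen_trickle al0 be0 XYZ YZX XZY s0 gamX.
    by rewrite -ler_pdivlMr // leNgt cs.
  have [k fk] := conn _ _ fg => x.
  have -> : q x * f x = wsum w (fun o => I x o * f (X o)).
    rewrite mulrC -wsumZ; apply: eq_wsum => o; rewrite /I.
    by case: eqP => [->|]; rewrite ?mulr0 ?mul0r // mulrC.
  have [m0|m0] := eqVneq m 0; first by apply: wsum0.
  have k0 : k = 0.
    have : wsum w (f \o X) = k * m.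
      rewrite /m -wsumZ; apply: eq_bigr => o _; rewrite mulr1 /=.
      by have [->|wo] := eqVneq (w o) 0; [rewrite !mul0r | rewrite fk].
    by move/eqP; rewrite f0 eq_sym mulf_eq0 (negPf m0) orbF => /eqP.
  apply: big1 => o _; have [->|wo] := eqVneq (w o) 0; first by rewrite mul0r.
  by rewrite fk // k0 !mulr0.
move=> f g.
set mf := wsum w (f \o X) / m; set mg := wsum w (g \o Y) / m.
pose f' x := f x - mf; pose g' y := g y - mg.
have f'0 : wsum w (f' \o X) = 0 by apply: wsum_center.
have g'0 : wsum w (g' \o Y) = 0 by apply: wsum_center.
have covE F G a b : cov w F G = cov w (fun o => F o - a) (fun o => G o - b).
  by rewrite cov_shiftl // cov_shiftr.
have -> : cov w (f \o X) (g \o Y) = wsum w (fun o => g' (Y o) * f' (X o)).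
  by rewrite covC (covE _ _ mg mf) cov_centered.
have -> : cov w (f \o X) (f \o X) = wsum w (fun o => f' (X o) ^+ 2).
  by rewrite (covE _ _ mf mf) cov_centered.
have -> : cov w (g \o Y) (g \o Y) = wsum w (fun o => g' (Y o) ^+ 2).
  by rewrite (covE _ _ mg mg) cov_centered.
have := bound f'; rewrite f'0 expr0n mul0r subr0 => bf.
rewrite -(wsum_cexp w_ge0 Y (f' \o X) g').
(* After centring, 2 Cov(f, g) <= Var E[f|Y] + Var g by expanding a square, and the first term is at
   most c Var f. *)
have : 0 <= wsum w (fun o => (g' (Y o) - cexp w Y (f' \o X) (Y o)) ^+ 2).
  by apply: wsum_ge0 => // o; apply: sqr_ge0.
rewrite wsum_sqB; lra.
Qed.

End Trickle.
End Covariance.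

(** * Correlation bounds under equal and zero weights *)

Section ZeroWeight.
Variables (R : rcfType) (O U : finType).

Lemma eq_corr_le (w w' : O -> R) (X Y : O -> U) c :
  w =1 w' -> corr_le w X Y c -> corr_le w' X Y c.
Proof.
move=> ww XY f g.
have wsumE F : wsum w' F = wsum w F by apply: eq_bigr => s _; rewrite ww.
by have := XY f g; rewrite /cov !wsumE.
Qed.

Lemma corr_le0 (X Y : O -> U) c : corr_le (fun=> 0 : R) X Y c.
Proof.
have wsumE F : wsum (fun=> 0 : R) F = 0 :> R.
  by apply: big1 => s _; rewrite mul0r.
by move=> f g; rewrite /cov !wsumE !mul0r subr0 !mulr0 addr0.
Qed.

End ZeroWeight.

(** * A random facet through a face as a family of random vertices, one per missing part *)

Section Complex.
Variables (R : realType) (V : finType) (d : nat).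
Variables (X : {set {set V}}) (T : 'I_d -> {set V}) (mu : {set V} -> R).
Hypotheses (X_complex : simplicial_complex X) (X_pure : pure X d).
Hypotheses (X_partite : partite X T) (mu_distr : facet_distribution X d mu).
Variable p : 'S_d.
Implicit Types (s tau : {set V}) (n i j l m a b : nat).

(* Positions run from 1 to d, so that 0 and d.+1 serve as the fixed ends of the path:
   [part] is empty and [free] is false there. *)
Definition part n : {set V} := \bigcup_(i < d | i.+1 == n) T (p i).

(** The random variable of position n. On a facet it is the singleton of the vertex in that part, so
    values are taken in sets and no default vertex is needed. *)
Definition slot n s : {set V} := s :&: part n.

Definition free tau n : bool := (0 < n <= d)%N && (tau :&: part n == set0).

(** Unnormalised law of a facet conditioned to contain [tau]. *)
Definition wt tau s : R := if (s \in faces X d) && (tau \subset s) then mu s else 0.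

Lemma partE (i : 'I_d) : part i.+1 = T (p i).
Proof.
rewrite /part (bigD1 i) //= big1 ?setU0 // => j /andP[/eqP[/val_inj ->]].
by rewrite eqxx.
Qed.

Lemma part_ord n : (0 < n <= d)%N -> exists2 i : 'I_d, n = i.+1 & part n = T (p i).
Proof.
case: n => // n /andP[_ nd]; exists (Ordinal nd) => //; exact: (partE (Ordinal nd)).
Qed.

Lemma part_inj x m n : x \in part m -> x \in part n -> m = n.
Proof.
case: X_partite => _ disj _ /bigcupP[i /eqP <- xi] /bigcupP[j /eqP <- xj].
have [->//|ij] := eqVneq i j.
have /disj/disjoint_setI0/setP/(_ x) : p i != p j by rewrite (inj_eq perm_inj).
by rewrite !inE xi xj.
Qed.

Lemma part_bound x n : x \in part n -> (0 < n <= d)%N.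
Proof. by case/bigcupP => i /eqP <- _; exact: ltn_ord. Qed.

Lemma facet_face s : s \in faces X d -> s \in X.
Proof. by rewrite inE => /andP[]. Qed.

Lemma slot_facet s n : s \in faces X d -> (0 < n <= d)%N -> exists x, slot n s = [set x].
Proof.
case: X_partite => _ _ Tcard sX /part_ord[i _ E]; apply/cards1P.
by rewrite /slot E Tcard.
Qed.

Lemma facet_part s x : s \in faces X d -> x \in s -> exists n, x \in part n.
Proof.
case: X_partite => Tcover _ _ sX xs.
have : x \in \bigcup_(i < d) T i.
  rewrite Tcover !inE cards1 eqxx andbT; apply: X_complex (facet_face sX) _.
  by rewrite sub1set.
case/bigcupP => i _ xi; exists ((p^-1)%g i).+1.
by rewrite partE permKV.
Qed.

Lemma face_facet tau : tau \in X -> exists2 s, s \in faces X d & tau \subset s.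
Proof.
move=> tX; have [s smax ts] := maxset_exists (P := fun t => t \in X) tX.
exists s => //; rewrite inE X_pure // eqxx andbT.
by case/maxsetP: smax.
Qed.

Lemma wt_ge0 tau s : 0 <= wt tau s.
Proof.
rewrite /wt; case: ifP => // /andP[sX _]; apply: ltW.
by case: mu_distr => /(_ s sX).
Qed.

Lemma wt_neq0 tau s : (wt tau s != 0) = (s \in faces X d) && (tau \subset s).
Proof.
rewrite /wt; case: ifP; rewrite ?eqxx // => /andP[sX _].
by case: mu_distr => /(_ s sX) /gt_eqF ->.
Qed.

Lemma slotP s n x : s \in faces X d -> x \in s -> x \in part n -> slot n s = [set x].
Proof.
move=> sX xs xn; have [y E] := slot_facet sX (part_bound xn).
have : x \in slot n s by rewrite inE xs.
by rewrite E inE => /eqP ->.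
Qed.

Lemma free_notin tau s n x : s \in faces X d -> tau \subset s -> x \in s -> x \in part n ->
  free tau n = (x \notin tau).
Proof.
move=> sX ts xs xn; rewrite /free (part_bound xn) /=.
have [xt|xt] := boolP (x \in tau).
  by apply/negbTE/set0Pn; exists x; rewrite inE xt.
apply/eqP/setP => y; rewrite !inE; apply: contraNF xt => /andP[yt yn].
have := slotP sX xs xn; rewrite (slotP sX (subsetP ts _ yt) yn) => /set1_inj <- //.
Qed.

Lemma sum_free (f : V -> R) tau s : s \in faces X d -> tau \subset s ->
  \sum_(x in s :\: tau) f x = \sum_(i < d.+1 | free tau i) \sum_(x in slot i s) f x.
Proof.
move=> sX ts; rewrite (exchange_big_dep (fun x => x \in s)) /=; last first.
  by move=> i x _; rewrite inE => /andP[].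
rewrite big_mkcond [RHS]big_mkcond; apply: eq_bigr => x _; rewrite inE.
case xs : (x \in s); rewrite ?andbF ?andbT //.
have [n xn] := facet_part sX xs.
have nd : (n < d.+1)%N by have /andP[] := part_bound xn.
have := free_notin sX ts xs xn.
case: ifP => [_ fn|_ fn]; last first.
  rewrite big1 // => i /andP[fi]; rewrite inE => /andP[_ xi].
  by move: fi; rewrite -(part_inj xn xi) fn.
rewrite (bigD1 (Ordinal nd)) /=; last by rewrite fn inE xs.
rewrite big1 ?addr0 // => i /andP[/andP[_]]; rewrite inE => /andP[_ xi] /eqP[].
by apply: val_inj; rewrite /= (part_inj xn xi).
Qed.

Lemma sum_slot (f : V -> R) s n : s \in faces X d -> (0 < n <= d)%N ->
  \sum_(x in slot n s) f x ^+ 2 = (\sum_(x in slot n s) f x) ^+ 2.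
Proof. by move=> sX /(slot_facet sX)[x ->]; rewrite !big_set1. Qed.

Lemma card_free tau : tau \in X -> #|[pred i : 'I_d.+1 | free tau i]| = codim d tau.
Proof.
move=> /face_facet[s sX ts].
have scard : #|s| = d by move: sX; rewrite inE => /andP[_ /eqP].
have -> : codim d tau = #|s :\: tau|.
  by rewrite cardsD (setIidPr ts) scard.
(* Count the vertices outside [tau] by summing the constant 1 over the free positions. *)
apply/eqP; rewrite -(eqr_nat R) -!sumr_const; apply/eqP.
rewrite sum_free //; apply: eq_bigr => i /andP[/(slot_facet sX)[x ->] _].
by rewrite big_set1.
Qed.

Definition free_seq tau : seq nat := map (@nat_of_ord d.+1) (enum [pred i : 'I_d.+1 | free tau i]).

Lemma mem_free_seq tau n : (n \in free_seq tau) = free tau n.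
Proof.
apply/mapP/idP => [[i + ->]|fn]; first by rewrite mem_enum.
have nd : (n < d.+1)%N by case/andP: fn => /andP[].
by exists (Ordinal nd); rewrite ?mem_enum.
Qed.

Lemma free_seq_uniq tau : uniq (free_seq tau).
Proof. by rewrite map_inj_uniq ?enum_uniq //; apply: val_inj. Qed.

Lemma size_free_seq tau : tau \in X -> size (free_seq tau) = codim d tau.
Proof. by move=> tX; rewrite size_map -cardE card_free. Qed.

Lemma free_size tau (l : seq nat) : tau \in X -> uniq l -> all (free tau) l ->
  (size l <= codim d tau)%N.
Proof.
move=> tX ul /allP fl; rewrite -size_free_seq //; apply: uniq_leq_size => // n /fl.
by rewrite mem_free_seq.
Qed.

Lemma free_other tau (l : seq nat) : tau \in X -> (size l < codim d tau)%N ->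
  exists2 n, free tau n & n \notin l.
Proof.
move=> tX; rewrite -size_free_seq // => lt.
have [/hasP[n]|/hasPn sub] := boolP (has [predC l] (free_seq tau)).
  by rewrite mem_free_seq; exists n.
move: lt; rewrite ltnNge uniq_leq_size ?free_seq_uniq // => n /sub.
by rewrite /= negbK.
Qed.

Lemma restr_wt tau l z : free tau l ->
  (exists x, [/\ x \in part l, x |: tau \in X &
                restr (wt tau) (slot l) z =1 wt (x |: tau)])
  \/ restr (wt tau) (slot l) z =1 fun=> 0.
Proof.
move=> /andP[ld _].
case: (pickP [pred s | (wt tau s != 0) && (slot l s == z)]) => [s0|none]; last first.
  right => s; rewrite /restr; case: ifP => // E; apply/eqP; move/negbT: (none s).
  by rewrite /= E andbT negbK.
move=> /andP[]; rewrite wt_neq0 => /andP[s0X ts0] /eqP <-.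
have [x E] := slot_facet s0X ld.
have : x \in slot l s0 by rewrite E inE.
rewrite inE => /andP[xs0 xl]; left; exists x; split=> //.
  by apply: X_complex (facet_face s0X) _; rewrite subUset sub1set xs0.
move=> s; rewrite /restr /wt E subUset sub1set.
case sX : (s \in _); rewrite /= ?if_same //.
have -> : (slot l s == [set x]) = (x \in s).
  apply/eqP/idP => [Es|xs]; last exact: slotP.
  by have : x \in slot l s; [rewrite Es inE | rewrite inE => /andP[]].
by case: (x \in s).
Qed.

Lemma free_add tau x l n : free tau l -> x \in part l ->
  free (x |: tau) n = free tau n && (n != l).
Proof.
move=> fl xl; rewrite /free.
have [->|nl] := eqVneq n l.
  rewrite andbF; apply/negbTE; rewrite negb_and; apply/orP; right.
  by apply/set0Pn; exists x; rewrite !inE eqxx xl.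
rewrite andbT setIUl; have -> : [set x] :&: part n = set0; last by rewrite set0U.
apply/setP => y; rewrite !inE; apply: contraNF nl => /andP[/eqP -> xn].
by rewrite (part_inj xn xl).
Qed.

Lemma codim_add tau x l : free tau l -> x \in part l -> codim d (x |: tau) = (codim d tau).-1.
Proof.
move=> /andP[_ /eqP fl] xl; rewrite /codim cardsU1 -subnS; congr (_ - _)%N.
suff -> : x \notin tau by [].
by apply/negP => xt; move/setP/(_ x): fl; rewrite !inE xt xl.
Qed.

Lemma cond_corr_wt tau l (Y Z : {set V} -> {set V}) c : free tau l ->
  (forall x, x \in part l -> x |: tau \in X -> corr_le (wt (x |: tau)) Y Z c) ->
  forall z, corr_le (restr (wt tau) (slot l) z) Y Z c.
Proof.
move=> fl H z; have [[x [xl xX E]]|E] := restr_wt z fl.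
  by apply: (eq_corr_le (fsym E)); apply: H.
by apply: (eq_corr_le (fsym E)); apply: corr_le0.
Qed.

(** * Vertices and edges of links, and probabilities as weighted sums *)

Lemma linkP tau (A : {set V}) :
  reflect ([disjoint A & tau] /\ A :|: tau \in X) (A \in link X tau).
Proof.
apply: (iffP imsetP) => [[s]|[dis AX]].
  rewrite inE => /andP[sX ts] ->; split.
    by rewrite -setI_eq0; apply/eqP/setP => x; rewrite !inE; case: (x \in tau); rewrite ?andbF.
  suff -> : s :\: tau :|: tau = s by [].
  apply/setP => x; rewrite !inE; have := subsetP ts x.
  by case: (x \in tau) => [->|_]; rewrite ?orbT ?orbF.
exists (A :|: tau); first by rewrite inE AX subsetUr.
by rewrite setDUl setDv setU0; apply/esym/setDidPl.
Qed.

Lemma link_vertexP tau x :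
  reflect (x \notin tau /\ exists s, [/\ s \in faces X d, tau \subset s & x \in s])
          (x \in vertices (link X tau)).
Proof.
rewrite !inE cards1 eqxx andbT; apply: (iffP (linkP _ _)); rewrite disjoints1.
  case=> xt /face_facet[s sX]; rewrite subUset sub1set => /andP[xs ts].
  by split=> //; exists s.
case=> xt [s [sX ts xs]]; split=> //; apply: X_complex (facet_face sX) _.
by rewrite subUset sub1set xs.
Qed.

Lemma link_edgeP tau x y :
  reflect [/\ x != y, x \notin tau, y \notin tau &
             exists s, [/\ s \in faces X d, tau \subset s, x \in s & y \in s]]
          (link_edge X tau x y).
Proof.
rewrite /link_edge inE cards2; have [->|xy] := eqVneq x y.
  by rewrite andbF; constructor => -[].
rewrite eqxx andbT; apply: (iffP (linkP _ _)).
all: rewrite -setI_eq0 setIUl setU_eq0 !setI_eq0 !disjoints1.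
  case=> /andP[xt yt] /face_facet[s sX]; rewrite !subUset !sub1set => /andP[/andP[xs ys] ts].
  by split=> //; exists s.
case=> _ xt yt [s [sX ts xs ys]]; rewrite xt yt; split=> //; apply: X_complex (facet_face sX) _.
by rewrite !subUset !sub1set xs ys.
Qed.

Lemma eq_wsum_wt tau (F G : {set V} -> R) :
  (forall s, s \in faces X d -> tau \subset s -> F s = G s) ->
  wsum (wt tau) F = wsum (wt tau) G.
Proof.
move=> FG; apply: eq_bigr => s _; have [->|] := eqVneq (wt tau s) 0; first by rewrite !mul0r.
by rewrite wt_neq0 => /andP[sX ts]; rewrite FG.
Qed.

Lemma prob_wsum tau (E : pred {set V}) :
  prob X d mu (fun s => E s && (tau \subset s)) = wsum (wt tau) (fun s => (E s)%:R).
Proof.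
rewrite /prob big_mkcond; apply: eq_bigr => s _; rewrite /wt.
by case: (s \in _); case: (E s); case: (tau \subset s); rewrite /= ?mulr1 ?mulr0 ?mul0r.
Qed.

Lemma prob_total tau : prob X d mu (fun s => tau \subset s) = wsum (wt tau) (fun=> 1).
Proof. exact: (prob_wsum tau predT). Qed.

Lemma wt_total tau : tau \in X -> 0 < wsum (wt tau) (fun=> 1).
Proof.
move=> /face_facet[s sX ts]; rewrite lt_neqAle eq_sym wsum_ge0 ?andbT => [|s'|s'];
  rewrite ?wt_ge0 ?ler01 //.
apply/negP; rewrite psumr_eq0 => [/allP/(_ s (mem_index_enum _))|s' _]; last first.
  by rewrite mulr1 wt_ge0.
by rewrite mulr1 /= -[_ == 0]negbK wt_neq0 sX ts.
Qed.

(** * The condition lambda_2 <= 1/2 on a link as a variance inequality *)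

Section LinkWalk.
Variables (tau : {set V}) (k : nat).
Hypotheses (tX : tau \in X) (tcodim : codim d tau = k.+2).

Let Vt := vertices (link X tau).
Let w := wt tau.
Let m := wsum w (fun=> 1).
Let a F G := wsum w (fun s => (F \in s)%:R * (G \in s)%:R).

Let m_gt0 : 0 < m. Proof. exact: wt_total. Qed.

Lemma sum_link_vertices s (h : V -> R) : s \in faces X d -> tau \subset s ->
  \sum_(F in Vt) (F \in s)%:R * h F = \sum_(F in s :\: tau) h F.
Proof.
move=> sX ts; rewrite big_mkcond [RHS]big_mkcond; apply: eq_bigr => F _.
rewrite in_setD.
case Fs : (F \in s); last by rewrite andbF mul0r if_same.
rewrite mul1r andbT; have -> // : (F \in Vt) = (F \notin tau).
by apply/link_vertexP/idP => [[]//|Ft]; split=> //; exists s.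
Qed.

Lemma link_weightE F G : F \in Vt -> G \in Vt ->
  link_weight X d mu tau F G = (F != G)%:R * (a F G / m).
Proof.
move=> /link_vertexP[Ft _] /link_vertexP[Gt _]; rewrite /link_weight.
case: link_edgeP => [[FG _ _ _]|nE].
  rewrite FG mul1r /cprob prob_total (prob_wsum tau (fun s => (F \in s) && (G \in s))).
  by congr (_ / _); apply: eq_wsum => s; rewrite -natrM mulnb.
have [->|FG] := eqVneq F G; first by rewrite mul0r.
rewrite /a (eq_wsum_wt (G := fun=> 0)) ?mul1r => [|s sX ts].
  by rewrite [wsum _ _]big1 ?mul0r // => s _; rewrite mulr0.
rewrite -natrM mulnb; case: andP => // -[Fs Gs]; case: nE; split=> //.
by exists s.
Qed.

Let aC F G : a F G = a G F.
Proof. by apply: eq_wsum => s; rewrite mulrC. Qed.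

Let sum_a F (h : V -> R) : \sum_(G in Vt) a F G * h G
  = wsum w (fun s => (F \in s)%:R * \sum_(G in s :\: tau) h G).
Proof.
under eq_bigr do rewrite mulrC -wsumZ.
transitivity (wsum w (fun s => \sum_(G in Vt) h G * ((F \in s)%:R * (G \in s)%:R))).
  by rewrite /wsum exchange_big; apply: eq_bigr => s _; rewrite mulr_sumr.
apply: eq_wsum_wt => s sX ts; rewrite -sum_link_vertices // mulr_sumr.
by apply: eq_bigr => G _; ring.
Qed.

Let sum_Vt (h : V -> R) (K : {set V} -> R) :
  \sum_(F in Vt) h F * wsum w (fun s => (F \in s)%:R * K s)
  = wsum w (fun s => (\sum_(F in s :\: tau) h F) * K s).
Proof.
under eq_bigr do rewrite -wsumZ.
transitivity (wsum w (fun s => \sum_(F in Vt) h F * ((F \in s)%:R * K s))).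
  by rewrite /wsum exchange_big; apply: eq_bigr => s _; rewrite mulr_sumr.
apply: eq_wsum_wt => s sX ts; rewrite -sum_link_vertices // mulr_suml.
by apply: eq_bigr => F _; ring.
Qed.

Let sum_lw F (h : V -> R) : F \in Vt ->
  \sum_(G in Vt) link_weight X d mu tau F G * h G
  = (wsum w (fun s => (F \in s)%:R * \sum_(G in s :\: tau) h G)
     - h F * wsum w (fun s => (F \in s)%:R)) / m.
Proof.
move=> FV; rewrite -sum_a (bigD1 F) //= [in RHS](bigD1 F) //=.
rewrite link_weightE // eqxx !mul0r add0r.
have -> : a F F = wsum w (fun s => (F \in s)%:R).
  by apply: eq_wsum => s; rewrite -natrM mulnb andbb.
rewrite [_ * h F]mulrC addrAC subrr add0r mulr_suml; apply: eq_bigr => G /andP[GV GF].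
by rewrite link_weightE // eq_sym GF mul1r mulrAC.
Qed.

Let q F := \sum_(G in Vt) link_weight X d mu tau F G.

Let qE F : F \in Vt -> q F = k.+1%:R * wsum w (fun s => (F \in s)%:R) / m.
Proof.
move=> FV; have := sum_lw (fun=> 1) FV; rewrite mul1r.
under eq_bigr do rewrite mulr1; rewrite -/(q F) => ->; congr (_ / _).
have -> : wsum w (fun s => (F \in s)%:R * \sum_(G in s :\: tau) 1)
   = k.+2%:R * wsum w (fun s => (F \in s)%:R).
  rewrite -wsumZ; apply: eq_wsum_wt => s sX ts; rewrite mulrC; congr (_ * _).
  rewrite sumr_const cardsD (setIidPr ts) -tcodim /codim.
  by move: sX; rewrite inE => /andP[_ /eqP ->].
by rewrite -[k.+2]addn1 natrD; ring.
Qed.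

(** In codimension k + 2 a facet through F has k + 1 further link vertices, so the degree of F is (k
    + 1) P(F). As the graph has no loops, its quadratic form is E[(sum f)^2] - E[sum f^2]; moving
    the diagonal term to the right produces the 1 in 1 + (k + 1)/2. *)
Lemma link_walkP :
  lambda2 (link_walk X d mu tau) <= 1 / 2 <->
  forall f : V -> R, wsum w (fun s => \sum_(x in s :\: tau) f x) = 0 ->
    wsum w (fun s => (\sum_(x in s :\: tau) f x) ^+ 2)
      <= (1 + k.+1%:R / 2) * wsum w (fun s => \sum_(x in s :\: tau) f x ^+ 2).
Proof.
have qgt0 F : F \in Vt -> 0 < q F.
  move=> FV; rewrite qE //; have /link_vertexP[Ft [s [sX ts Fs]]] := FV.
  rewrite divr_gt0 // mulr_gt0 ?ltr0n // /wsum (bigD1 s) //= ltr_pwDl //.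
    by rewrite Fs mulr1 lt_neqAle eq_sym wt_neq0 sX ts wt_ge0.
  by apply: sumr_ge0 => s' _; rewrite mulr_ge0 ?wt_ge0 ?ler0n.
have [F0 F0V] : exists F, F \in Vt.
  have [s sX ts] := face_facet tX.
  have /set0Pn[F] : s :\: tau != set0.
    rewrite -card_gt0 cardsD (setIidPr ts).
    have -> : #|s| = d by move: sX; rewrite inE => /andP[_ /eqP].
    by rewrite -[(d - _)%N]/(codim d tau) tcodim.
  rewrite inE => /andP[Ft Fs]; exists F; apply/link_vertexP; split=> //; by exists s.
have mV : m != 0 by rewrite gt_eqF.
pose N (i j : 'I_#|Vt|) := link_weight X d mu tau (enum_val i) (enum_val j).
have walkE : link_walk X d mu tau = \matrix_(i, j) (N i j / q (enum_val i)) by [].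
have quadE (f : V -> R) : \sum_(F in Vt) \sum_(G in Vt) link_weight X d mu tau F G * f F * f G
    = (wsum w (fun s => (\sum_(x in s :\: tau) f x) ^+ 2)
       - wsum w (fun s => \sum_(x in s :\: tau) f x ^+ 2)) / m.
  transitivity (\sum_(F in Vt) f F * (\sum_(G in Vt) link_weight X d mu tau F G * f G)).
    by apply: eq_bigr => F FV; rewrite mulr_sumr; apply: eq_bigr => G _; ring.
  transitivity (\sum_(F in Vt) (f F * wsum w (fun s => (F \in s)%:R * \sum_(G in s :\: tau) f G)
       - f F ^+ 2 * wsum w (fun s => (F \in s)%:R * 1)) / m).
    apply: eq_bigr => F FV; rewrite sum_lw // (eq_wsum _ (fun s => mulr1 (F \in s)%:R)).
    by field.
  rewrite -mulr_suml sumrB !sum_Vt; congr ((_ - _) / _).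
  by apply: eq_wsum => s; rewrite mulr1.
have normE (h : V -> R) : \sum_(F in Vt) q F * h F
    = k.+1%:R / m * wsum w (fun s => \sum_(x in s :\: tau) h x).
  transitivity (k.+1%:R / m * \sum_(F in Vt) h F * wsum w (fun s => (F \in s)%:R * 1)).
    rewrite mulr_sumr; apply: eq_bigr => F FV; rewrite qE //.
    by rewrite (eq_wsum _ (fun s => mulr1 (F \in s)%:R)); ring.
  by rewrite sum_Vt; congr (_ * _); apply: eq_wsum => s; rewrite mulr1.
have kmV : k.+1%:R / m != 0 by rewrite mulf_neq0 ?invr_eq0 ?pnatr_eq0.
have ineqE (Q S : R) : ((Q - S) / m <= 1 / 2 * (k.+1%:R / m * S)) = (Q <= (1 + k.+1%:R / 2) * S).
  rewrite -(ler_pM2r m_gt0).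
  have -> : (Q - S) / m * m = Q - S by field.
  have -> : 1 / 2 * (k.+1%:R / m * S) * m = k.+1%:R / 2 * S by field.
  by rewrite lerBlDl mulrDl mul1r.
rewrite walkE (@lambda2_walkP _ _ (fun i : 'I_#|Vt| => q (enum_val i)) N); first last.
- by apply/andP; split; lra.
- by apply/card_gt0P; exists F0.
- by move=> i; rewrite /N -(big_enum_val (link_weight X d mu tau (enum_val i))).
- by move=> i; apply/qgt0/enum_valP.
- by move=> i j /eqP; rewrite gt_eqF // qgt0 // enum_valP.
- by move=> i j; rewrite /N !link_weightE ?enum_valP // eq_sym aC.
- by move=> i; apply/ltW/qgt0/enum_valP.
have sumE (h : V -> R) : \sum_(i < #|Vt|) h (enum_val i) = \sum_(F in Vt) h F.
  by rewrite -(big_enum_val h).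
split=> H f.
  move=> f0; rewrite -ineqE -quadE -(normE (fun x => f x ^+ 2)).
  have := H (fun i : 'I_#|Vt| => f (enum_val i)).
  rewrite (sumE (fun F => q F * f F)) (normE f) f0 mulr0 => /(_ erefl).
  rewrite (sumE (fun F => q F * f F ^+ 2)) -(sumE (fun F => \sum_(G in Vt) _)).
  by under [X in _ -> X <= _]eq_bigr do rewrite -sumE.
move=> f0; pose g x := f (enum_rank_in F0V x).
have gE (i : 'I_#|Vt|) : g (enum_val i) = f i by rewrite /g enum_valK_in.
have := H g; rewrite -ineqE -quadE -(normE (fun x => g x ^+ 2)).
rewrite -(sumE (fun F => q F * g F ^+ 2)) -(sumE (fun F => \sum_(G in Vt) _)).
under [X in (_ -> X <= _) -> _]eq_bigr do rewrite -sumE.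
under [X in (_ -> X <= _) -> _]eq_bigr do under eq_bigr do rewrite !gE.
under [X in (_ -> _ <= _ * X) -> _]eq_bigr do rewrite gE.
apply; apply: (mulfI kmV); rewrite mulr0 -(normE g) -(sumE (fun F => q F * g F)) -[RHS]f0.
by apply: eq_bigr => i _; rewrite gE.
Qed.

End LinkWalk.

(** * Connectivity of links, independence of slots, and codimension two *)

Hypothesis X_connected : connected_complex X d.

(** Two facets with a common vertex v outside [tau] agree on f(slot j): directly if v lies in
    position j or i, and otherwise by induction in the link of v. Connectivity of the link graph
    propagates the value to all facets. *)
Lemma slot_connected k : forall tau j i (f g : {set V} -> R),
  tau \in X -> codim d tau = k.+2 -> free tau j -> free tau i -> j != i ->
  (forall s, wt tau s != 0 -> f (slot j s) = g (slot i s)) ->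
  forall s s', wt tau s != 0 -> wt tau s' != 0 -> f (slot j s) = f (slot j s').
Proof.
elim/ltn_ind: k => k IHk tau j i f g tX tcodim fj fi ji fg s1 s2 w1 w2.
have shared v s s' : v \notin tau -> v \in s -> v \in s' -> wt tau s != 0 ->
    wt tau s' != 0 -> f (slot j s) = f (slot j s').
  move=> vt vs vs' ws ws'; move: (ws) (ws'); rewrite !wt_neq0 => /andP[sX ts] /andP[s'X ts'].
  have [n vn] := facet_part sX vs.
  have fn : free tau n by rewrite (free_notin sX ts vs vn).
  have [E|nj] := eqVneq n j; first by rewrite -E !(slotP _ _ vn).
  have [E|ni] := eqVneq n i; first by rewrite !fg // -E !(slotP _ _ vn).
  (* Three distinct free positions force codimension at least 3, so the link of v is still covered
     by the induction. *)
  have := free_size (l := [:: n; j; i]) tX.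
  rewrite /= !inE (negPf nj) (negPf ni) (negPf ji) fn fj fi tcodim => /(_ isT isT).
  case: k IHk tcodim => // k IHk tcodim _.
  have fE m : free (v |: tau) m = free tau m && (m != n) by apply: free_add.
  have wv (t : {set V}) : v \in t -> wt tau t != 0 -> wt (v |: tau) t != 0.
    by rewrite !wt_neq0 subUset sub1set => -> /andP[-> ->].
  apply: (IHk k _ (v |: tau) j i f g) => //.
  - by apply: X_complex (facet_face sX) _; rewrite subUset sub1set vs.
  - by rewrite (codim_add fn vn) tcodim.
  - by rewrite fE fj eq_sym.
  - by rewrite fE fi eq_sym.
  - move=> t; rewrite wt_neq0 subUset sub1set => /and3P[tX' vt' ttau]; apply: fg.
    by rewrite wt_neq0 tX'.
  - exact: wv.
  - exact: wv.
(* Vertices all of whose facets carry the value of [s1]. By [shared] this set is closed under the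
   edges of the link. *)
pose a := [pred v | [forall s, ((wt tau s != 0) && (v \in s)) ==> (f (slot j s) == f (slot j s1))]].
have mem_slot s : wt tau s != 0 -> exists2 v, v \in s & v \notin tau.
  rewrite wt_neq0 => /andP[sX ts].
  have [x E] : exists x, slot j s = [set x] by apply: slot_facet => //; case/andP: fj.
  have : x \in slot j s by rewrite E inE.
  by rewrite inE => /andP[xs xj]; exists x; rewrite // -(free_notin sX ts xs xj).
have [v1 v1s v1t] := mem_slot _ w1; have [v2 v2s v2t] := mem_slot _ w2.
have v1a : v1 \in a.
  by apply/forallP => s; apply/implyP => /andP[ws vs]; apply/eqP; apply: (shared v1).
have vert v s : v \in s -> v \notin tau -> wt tau s != 0 -> v \in vertices (link X tau).
  by move=> vs vt; rewrite wt_neq0 => /andP[sX ts]; apply/link_vertexP; split=> //; exists s.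
have edge_a u v : link_edge X tau u v -> u \in a -> v \in a.
  move=> /link_edgeP[_ ut vt [s [sX ts us vs]]] /forallP/(_ s)/implyP.
  have ws : wt tau s != 0 by rewrite wt_neq0 sX.
  rewrite ws us => /(_ isT)/eqP Es.
  apply/forallP => s'; apply/implyP => /andP[ws' vs']; rewrite -Es.
  by apply/eqP/(shared v).
have cl : closed (link_edge X tau) a.
  move=> u v uv; apply/idP/idP; apply: edge_a => //.
  by rewrite /link_edge setUC.
have := X_connected tX; rewrite tcodim => /(_ isT) conn.
have := closed_connect cl (conn _ _ (vert _ _ v1s v1t w1) (vert _ _ v2s v2t w2)).
rewrite v1a => /esym/forallP/(_ s2); rewrite w2 v2s => /eqP ->.
by [].
Qed.

Lemma eq_cov_wt tau (F F' G G' : {set V} -> R) :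
  (forall s, s \in faces X d -> tau \subset s -> F s = F' s) ->
  (forall s, s \in faces X d -> tau \subset s -> G s = G' s) ->
  cov (wt tau) F G = cov (wt tau) F' G'.
Proof.
move=> FF GG; rewrite /cov (eq_wsum_wt FF) (eq_wsum_wt GG); congr (_ - _).
by apply: eq_wsum_wt => s sX ts; rewrite FF ?GG.
Qed.

Lemma slot_indicator (f : {set V} -> R) s n : s \in faces X d -> (0 < n <= d)%N ->
  f (slot n s) = \sum_(x in part n) f [set x] * (x \in s)%:R.
Proof.
move=> sX nd; have [x E] := slot_facet sX nd.
have : x \in slot n s by rewrite E inE.
rewrite inE => /andP[xs xn]; rewrite E (bigD1 x) //= xs mulr1 big1 ?addr0 // => y /andP[yn yx].
case ys : (y \in s); last by rewrite mulr0.
have : y \in slot n s by rewrite inE ys.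
by rewrite E inE (negPf yx).
Qed.

(** Functions of a slot are linear combinations of vertex indicators, so bilinearity reduces the
    claim to pairs of vertices. *)
Lemma indep_corr_le tau j i : (0 < j <= d)%N -> (0 < i <= d)%N ->
  (forall F K, F \in part j -> K \in part i ->
    cprob X d mu (fun s => (F \in s) && (K \in s)) (fun s => tau \subset s)
    = cprob X d mu (fun s => F \in s) (fun s => tau \subset s)
      * cprob X d mu (fun s => K \in s) (fun s => tau \subset s)) ->
  corr_le (wt tau) (slot j) (slot i) 0.
Proof.
move=> jd id ind f g; set w := wt tau.
have -> : cov w (f \o slot j) (g \o slot i) = 0; last first.
  by rewrite mulr0 mul0r add0r; apply: cov_ge0 => s; apply: wt_ge0.
rewrite (@eq_cov_wt tau _ (fun s => \sum_(x in part j) f [set x] * (x \in s)%:R)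
   _ (fun s => \sum_(x in part i) g [set x] * (x \in s)%:R)); first last.
- by move=> s sX _; apply: slot_indicator.
- by move=> s sX _; apply: slot_indicator.
rewrite cov_suml big1 // => F Fj; rewrite cov_sumr big1 // => K Ki.
rewrite covZl covZr; suff -> : cov w (fun s => (F \in s)%:R) (fun s => (K \in s)%:R) = 0.
  by rewrite !mulr0.
have := ind F K Fj Ki; rewrite /cprob !prob_total !(prob_wsum tau) -/w /cov => H.
have -> : wsum w (fun s => (F \in s)%:R * (K \in s)%:R)
    = wsum w (fun s => ((F \in s) && (K \in s))%:R).
  by apply: eq_wsum => s; rewrite -natrM mulnb.
have [m0|m0] := eqVneq (wsum w (fun=> 1)) 0.
  have w0 s : 0 <= w s by apply: wt_ge0.
  by rewrite !(wsum0 _ w0 m0) !mul0r subr0.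
apply/eqP; rewrite subr_eq0; apply/eqP; apply: (mulIf (invr_neq0 m0)); rewrite H.
by rewrite -!mulrA; congr (_ * _); rewrite mulrCA.
Qed.

Lemma sum_two tau j i s (h : V -> R) : tau \in X -> codim d tau = 2%N ->
  free tau j -> free tau i -> j != i -> s \in faces X d -> tau \subset s ->
  \sum_(x in s :\: tau) h x = \sum_(x in slot j s) h x + \sum_(x in slot i s) h x.
Proof.
move=> tX tc fj fi ji sX ts; rewrite sum_free //.
have jd : (j < d.+1)%N by case/andP: fj => /andP[].
have id : (i < d.+1)%N by case/andP: fi => /andP[].
rewrite (bigD1 (Ordinal jd)) //= (bigD1 (Ordinal id)) /=; last first.
  by rewrite fi /= -val_eqE /= eq_sym.
rewrite [X in _ + (_ + X)]big1 ?addr0 // => l /andP[/andP[fl lj] li].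
have := free_size (l := [:: val l; j; i]) tX.
move: lj li; rewrite -!val_eqE /= !inE => lj li.
by rewrite (negPf lj) (negPf li) (negPf ji) fl fj fi tc => /(_ isT isT).
Qed.

(** Here k = 0 in [link_walkP], with factor 3/2. The constant 1/4 is the square of the eigenvalue
    bound 1/2, since the link is bipartite. *)
Lemma top_corr_le tau j i : tau \in X -> codim d tau = 2%N ->
  free tau j -> free tau i -> j != i ->
  lambda2 (link_walk X d mu tau) <= 1 / 2 ->
  corr_le (wt tau) (slot j) (slot i) (1 / 4).
Proof.
move=> tX tc fj fi ji /(link_walkP tX tc) H f g.
set w := wt tau in H *; have w0 s : 0 <= w s by apply: wt_ge0.
set mf := wsum w (f \o slot j) / wsum w (fun=> 1).
set mg := wsum w (g \o slot i) / wsum w (fun=> 1).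
pose P s := f (slot j s) - mf; pose Q s := g (slot i s) - mg.
(* Halving the first component gives PQ <= P^2/8 + Q^2/2 in expectation, which is the normalisation
   of [corr_le] with constant 1/4. *)
pose h x := if x \in part j then (f [set x] - mf) / 2 else g [set x] - mg.
have jd : (0 < j <= d)%N by case/andP: fj.
have i_d : (0 < i <= d)%N by case/andP: fi.
have hE (e : R -> R) s : s \in faces X d -> tau \subset s ->
    \sum_(x in s :\: tau) e (h x) = e (P s / 2) + e (Q s).
  move=> sX ts; rewrite (sum_two _ tX tc fj fi ji) // /P /Q.
  have [x xE] := slot_facet sX jd; have [y yE] := slot_facet sX i_d.
  have : x \in slot j s by rewrite xE inE.
  have : y \in slot i s by rewrite yE inE.
  rewrite !inE => /andP[_ yi] /andP[_ xj].
  rewrite xE yE !big_set1 /h xj; case: ifP => // yj.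
  by move: ji; rewrite (part_inj yj yi) eqxx.
have P0 : wsum w P = 0 by apply: wsum_center.
have Q0 : wsum w Q = 0 by apply: wsum_center.
have := H h; rewrite (eq_wsum_wt (hE id)) wsumD.
have -> : wsum w (fun s => P s / 2) = 2^-1 * wsum w P.
  by rewrite -wsumZ; apply: eq_wsum => s; rewrite mulrC.
rewrite P0 Q0 mulr0 addr0 => /(_ erefl).
rewrite (eq_wsum_wt (hE (fun y => y ^+ 2))).
have -> : wsum w (fun s => (\sum_(x in s :\: tau) h x) ^+ 2)
    = wsum w (fun s => (P s / 2 + Q s) ^+ 2).
  by apply: eq_wsum_wt => s sX ts; rewrite (hE id).
have covE F G (a b : R) : cov w F G = cov w (fun o => F o - a) (fun o => G o - b).
  by rewrite cov_shiftl // cov_shiftr.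
rewrite (covE _ (g \o _) mf mg) (covE (f \o _) (f \o _) mf mf) (covE (g \o _) (g \o _) mg mg).
rewrite -[fun o => (f \o slot j) o - mf]/P -[fun o => (g \o slot i) o - mg]/Q.
rewrite !cov_centered //.
have -> : wsum w (fun s => (P s / 2 + Q s) ^+ 2) = 4^-1 * wsum w (fun s => P s * P s)
   + wsum w (fun s => P s * Q s) + wsum w (fun s => Q s * Q s).
  by rewrite -wsumZ -!wsumD; apply: eq_wsum => s; field.
have -> : wsum w (fun s => (P s / 2) ^+ 2 + Q s ^+ 2) = 4^-1 * wsum w (fun s => P s * P s)
   + wsum w (fun s => Q s * Q s).
  by rewrite -wsumZ -!wsumD; apply: eq_wsum => s; field.
lra.
Qed.

(** * Algebra of Brownian bridge correlations *)

(* Squared correlation at times [j] and [i] of a Brownian bridge on [a, b]. *)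
Definition gapc a j i b : R :=
  ((j%:R - a%:R) * (b%:R - i%:R)) / ((i%:R - a%:R) * (b%:R - j%:R)).

Lemma gapc_bounds a j i b : (a < j)%N -> (j < i)%N -> (i < b)%N -> 0 <= gapc a j i b < 1.
Proof.
rewrite -!(ltr_nat R) => aj ji ib.
rewrite /gapc divr_ge0 ?mulr_ge0 ?subr_ge0 /=; try lra.
rewrite ltr_pdivrMr ?mul1r ?mulr_gt0 ?subr_gt0; try lra.
nra.
Qed.

(** The trickling-down bound reproduces the bridge: conditioning on position l moves the right end
    to l, conditioning on j moves the left end to j, and al / (1 - be) restores the ends a and b.
    The mirror image is [gapc_left]. *)
Lemma gapc_right a j i l b : (a < j)%N -> (j < i)%N -> (i < l)%N -> (l < b)%N ->
  gapc a j i l / (1 - gapc j i l b) = gapc a j i b.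
Proof.
rewrite -!(ltr_nat R) /gapc => aj ji il lb.
have -> : 1 - (i%:R - j%:R) * (b%:R - l%:R) / ((l%:R - j%:R) * (b%:R - i%:R))
    = ((l%:R - i%:R) * (b%:R - j%:R)) / ((l%:R - j%:R) * (b%:R - i%:R)) :> R.
  by field; apply/andP; split; apply/eqP; lra.
by field; rewrite -?andbA; repeat (apply/andP; split); apply/eqP; lra.
Qed.

Lemma gapc_left a l j i b : (a < l)%N -> (l < j)%N -> (j < i)%N -> (i < b)%N ->
  gapc l j i b / (1 - gapc a l j i) = gapc a j i b.
Proof.
rewrite -!(ltr_nat R) /gapc => al lj ji ib.
have -> : 1 - (l%:R - a%:R) * (i%:R - j%:R) / ((j%:R - a%:R) * (i%:R - l%:R))
    = ((j%:R - l%:R) * (i%:R - a%:R)) / ((j%:R - a%:R) * (i%:R - l%:R)) :> R.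
  by field; apply/andP; split; apply/eqP; lra.
by field; rewrite -?andbA; repeat (apply/andP; split); apply/eqP; lra.
Qed.

(** Markov property of the bridge: correlations multiply through an intermediate time. *)
Lemma gapc_mid a j l i b : (a < j)%N -> (j < l)%N -> (l < i)%N -> (i < b)%N ->
  gapc a j l b * gapc a l i b = gapc a j i b.
Proof.
rewrite -!(ltr_nat R) /gapc => aj jl li ib.
by field; rewrite -?andbA; repeat (apply/andP; split); apply/eqP; lra.
Qed.

(** With distances x, y >= 1 to the ends the value is xy / ((x + 1)(y + 1)), smallest at x = y = 1.
    This links the top-link bound 1/4 to the bridge. *)
Lemma gapc_adjacent a j b : (a < j)%N -> (j.+1 < b)%N -> 1 / 4 <= gapc a j j.+1 b.
Proof.
rewrite -(ler_nat R) -[(j.+1 < b)%N](ler_nat R) /gapc -(natr1 j.+1) -(natr1 j) -(natr1 a) => aj jb.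
rewrite ler_pdivlMr; last by apply: mulr_gt0; lra.
set x := j%:R - a%:R; set y := b%:R - (j%:R + 1).
have x1 : 1 <= x by rewrite /x; lra.
have y1 : 1 <= y by rewrite /y; lra.
have -> : j%:R + 1 - a%:R = x + 1 by rewrite /x; ring.
have -> : b%:R - j%:R = y + 1 by rewrite /y; ring.
have : 0 <= (x - 1) * (y - 1) by rewrite mulr_ge0 ?subr_ge0.
by move: x y x1 y1 => x y x1 y1; nra.
Qed.

(** The statement carried through the induction. The positions a and b are any non-free ones
    outside, including the ends 0 and [d.+1]; the second half says that a fixed position in between
    separates j from i. *)
Definition gap_corr tau := forall j i, (j < i)%N -> free tau j -> free tau i ->
  (forall a b, ~~ free tau a -> ~~ free tau b -> (a < j)%N -> (i < b)%N ->
     corr_le (wt tau) (slot j) (slot i) (gapc a j i b))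
  /\ (forall m, (j < m < i)%N -> ~~ free tau m -> corr_le (wt tau) (slot j) (slot i) 0).

(** A crude bound below 1 for any two free positions, for use as the parameter [be] when only
    [be < 1] matters. *)
Lemma gap_corr_weak tau x y : gap_corr tau -> free tau x -> free tau y -> x != y ->
  corr_le (wt tau) (slot x) (slot y) (gapc 0 (minn x y) (maxn x y) d.+1).
Proof.
have f0 : ~~ free tau 0 by [].
have fd : ~~ free tau d.+1 by rewrite /free ltnn andbF.
have bd n : free tau n -> (0 < n < d.+1)%N by case/andP.
move=> G fx fy; have /andP[x0 xd] := bd _ fx; have /andP[y0 yd] := bd _ fy.
case: ltngtP => // xy _.
  by have [H _] := G _ _ xy fx fy; apply: H.
have [H _] := G _ _ xy fy fx; apply: corr_le_sym; last exact: H.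
- by move=> s; apply: wt_ge0.
- by have /andP[] := gapc_bounds y0 xy xd.
Qed.

Lemma trickle_wt k tau x y z al be : tau \in X -> codim d tau = k.+2 ->
  free tau x -> free tau y -> free tau z -> x != y -> 0 <= al -> 0 <= be < 1 ->
  (forall v, v \in part z -> v |: tau \in X -> corr_le (wt (v |: tau)) (slot x) (slot y) al) ->
  (forall v, v \in part x -> v |: tau \in X -> corr_le (wt (v |: tau)) (slot y) (slot z) be) ->
  (forall v, v \in part y -> v |: tau \in X -> corr_le (wt (v |: tau)) (slot x) (slot z) 0) ->
  corr_le (wt tau) (slot x) (slot y) (al / (1 - be)).
Proof.
move=> tX tc fx fy fz xy al0 be01 hz hx hy.
apply: (@corr_le_trickle _ _ _ _ (wt_ge0 tau) _ _ (slot z)) => //.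
- exact: cond_corr_wt.
- exact: cond_corr_wt.
- exact: cond_corr_wt.
move=> f g fg; have [s sX ts] := face_facet tX.
exists (f (slot x s)) => o wo; apply: (slot_connected tX tc fx fy xy fg) => //.
by rewrite wt_neq0 sX.
Qed.

(** * Induction on the codimension for the bridge bound *)

Section Induction.
Hypothesis X_path : forall (i k : 'I_d), (i.+1 < k)%N ->
  forall F K, F \in T (p i) -> K \in T (p k) ->
  forall tau, tau \in X -> codim d tau = 2%N ->
    tau :&: \bigcup_(j < d | (i < j < k)%N) T (p j) != set0 ->
    cprob X d mu (fun s => (F \in s) && (K \in s)) (fun s => tau \subset s)
    = cprob X d mu (fun s => F \in s) (fun s => tau \subset s)
      * cprob X d mu (fun s => K \in s) (fun s => tau \subset s).
Hypothesis X_top_link : top_link_spectral_expander X d mu (1 / 2).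

Lemma gap_corr_top tau : tau \in X -> codim d tau = 2%N -> gap_corr tau.
Proof.
move=> tX tc j i ji fj fi.
have w0 s : 0 <= wt tau s by apply: wt_ge0.
have jd : (0 < j <= d)%N by case/andP: fj.
have i_d : (0 < i <= d)%N by case/andP: fi.
have indep m : (j < m < i)%N -> ~~ free tau m -> corr_le (wt tau) (slot j) (slot i) 0.
  move=> /andP[jm mi] fm; apply: indep_corr_le => // F K.
  have md : (0 < m <= d)%N by lia.
  have [j0 j0E ->] := part_ord jd; have [i0 i0E ->] := part_ord i_d.
  have [m0 m0E mE] := part_ord md.
  move=> Fj Ki; apply: (X_path _ Fj Ki tX tc); first by lia.
  move: fm; rewrite /free md /= => /set0Pn[x]; rewrite inE mE => /andP[xt xm].
  apply/set0Pn; exists x; rewrite inE xt; apply/bigcupP; exists m0 => //; lia.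
split=> // a b fa fb aj ib.
have [E|ne] := eqVneq i j.+1.
  rewrite E in fi ib *; apply: (corr_le_mono w0 (gapc_adjacent aj ib)).
  by apply: top_corr_le => //; [lia | apply: X_top_link].
(* If j and i are not adjacent, position j + 1 cannot be free, as codimension 2 leaves no third free
   position. The path hypothesis then gives independence. *)
have /andP[c0 _] := gapc_bounds aj ji ib.
apply: (corr_le_mono w0 c0); apply: (indep j.+1); first by lia.
apply/negP => fj1; have := free_size (l := [:: j.+1; j; i]) tX.
rewrite /= !inE fj fi fj1 tc => /(_ _ isT) H.
have : (3 <= 2)%N by apply: H; lia.
by [].
Qed.

Lemma gap_corr_all k tau : tau \in X -> codim d tau = k.+2 -> gap_corr tau.
Proof.
elim: k tau => [|k IHk] tau tX tc; first exact: gap_corr_top.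
have w0 s : 0 <= wt tau s by apply: wt_ge0.
have IHl l v : free tau l -> v \in part l -> v |: tau \in X -> gap_corr (v |: tau).
  by move=> fl vl vX; apply: IHk => //; rewrite (codim_add fl vl) tc.
have nonfree_add n v x : free tau n -> v \in part n -> ~~ free tau x || (x == n) ->
    ~~ free (v |: tau) x.
  by move=> fn vn; rewrite (free_add _ fn vn) negb_and negbK.
have neqL x y : (x < y)%N -> x != y by move=> xy; rewrite neq_ltn xy.
have neqG x y : (x < y)%N -> y != x by move=> xy; rewrite neq_ltn xy orbT.
have gap n j i a b : free tau n -> (j < i)%N -> free tau j -> free tau i ->
    j != n -> i != n -> ~~ free tau a || (a == n) -> ~~ free tau b || (b == n) ->
    (a < j)%N -> (i < b)%N -> forall v, v \in part n -> v |: tau \in X ->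
    corr_le (wt (v |: tau)) (slot j) (slot i) (gapc a j i b).
  move=> fn ji fj fi jn i_n fa fb aj ib v vn vX.
  have [||H _] := IHl n v fn vn vX j i ji; rewrite ?(free_add _ fn vn) ?fj ?fi //.
  by apply: H => //; apply: (nonfree_add n).
have zero n j i m : free tau n -> (j < m)%N -> (m < i)%N -> free tau j -> free tau i ->
    j != n -> i != n -> ~~ free tau m || (m == n) ->
    forall v, v \in part n -> v |: tau \in X ->
    corr_le (wt (v |: tau)) (slot j) (slot i) 0.
  move=> fn jm mi fj fi jn i_n fm v vn vX.
  have [||_ H] := IHl n v fn vn vX j i (ltn_trans jm mi); rewrite ?(free_add _ fn vn) ?fj ?fi //.
  by apply: (H m); [rewrite jm mi | apply: (nonfree_add n)].
have sym n x y c : 0 <= c ->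
    (forall v, v \in part n -> v |: tau \in X -> corr_le (wt (v |: tau)) (slot x) (slot y) c) ->
    forall v, v \in part n -> v |: tau \in X -> corr_le (wt (v |: tau)) (slot y) (slot x) c.
  by move=> c0 H v vn vX; apply: corr_le_sym => // [s|]; [exact: wt_ge0 | exact: H].
have bd n : free tau n -> (0 < n)%N /\ (n < d.+1)%N by case/andP => /andP[].
have be0 : is_true (0 <= (0 : R) < 1) by rewrite lexx ltr01.
have neq2 x y : (x < y)%N -> (x != y) * (y != x).
  by move=> xy; split; [apply: neqL | apply: neqG].
(* Trickling down along a third free position l outside the interval from j to i. Its neighbour
   among j and i is the middle variable Y, and l plays Z. *)
have outer j i l a b : (j < i)%N -> free tau j -> free tau i -> free tau l ->
    (l < j)%N || (i < l)%N ->
    ~~ free tau a -> ~~ free tau b -> (a < j)%N -> (i < b)%N ->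
    corr_le (wt tau) (slot j) (slot i) (gapc a j i b).
  move=> ji fj fi fl out fa fb aj ib.
  have /andP[c0 _] := gapc_bounds aj ji ib.
  case/orP: out => [lj|il].
    have li := ltn_trans lj ji.
    have neqE := (neq2 _ _ lj, neq2 _ _ li, neq2 _ _ ji).
    apply: corr_le_sym => //.
    have sep : forall v, v \in part j -> v |: tau \in X ->
        corr_le (wt (v |: tau)) (slot i) (slot l) 0.
      by apply: sym => //; apply: (zero j l i j); rewrite ?eqxx ?orbT ?neqE.
    (* If l is beyond the fixed position a, then l and j are independent given i, so be = 0 and the
       bound for the link passes unchanged; otherwise [gapc_left] applies. *)
    have [la|la|E] := ltngtP l a; last by move: fa; rewrite -E fl.
      rewrite -[gapc a j i b]divr1 -[X in _ / X]subr0.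
      apply: (trickle_wt tX tc fi fj fl); rewrite ?neqE //; apply: sym => //.
      - by apply: gap; rewrite ?fa ?fb ?neqE.
      - by apply: (zero i l j a); rewrite ?fa ?neqE.
    rewrite -(gapc_left la lj ji ib).
    have /andP[c1 _] := gapc_bounds lj ji ib.
    have c2 := gapc_bounds la lj ji.
    apply: (trickle_wt tX tc fi fj fl); rewrite ?neqE //; apply: sym => //.
    - by apply: gap; rewrite ?fb ?eqxx ?orbT ?neqE.
    - by case/andP: c2.
    - by apply: gap; rewrite ?fa ?eqxx ?orbT ?neqE.
  have jl := ltn_trans ji il.
  have neqE := (neq2 _ _ jl, neq2 _ _ il, neq2 _ _ ji).
  have sep : forall v, v \in part i -> v |: tau \in X ->
      corr_le (wt (v |: tau)) (slot j) (slot l) 0.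
    by apply: (zero i j l i); rewrite ?eqxx ?orbT ?neqE.
  have [bl|lb|E] := ltngtP b l; last by move: fb; rewrite E fl.
    rewrite -[gapc a j i b]divr1 -[X in _ / X]subr0.
    apply: (trickle_wt tX tc fj fi fl); rewrite ?neqE //.
    - by apply: gap; rewrite ?fa ?fb ?neqE.
    - by apply: (zero j i l b); rewrite ?fb ?neqE.
  rewrite -(gapc_right aj ji il lb).
  have /andP[c1 _] := gapc_bounds aj ji il.
  have c2 := gapc_bounds ji il lb.
  apply: (trickle_wt tX tc fj fi fl); rewrite ?neqE //.
  - by apply: gap; rewrite ?fa ?eqxx ?orbT ?neqE.
  - by apply: gap; rewrite ?fb ?eqxx ?orbT ?neqE.
move=> j i ji fj fi.
have [l fl] : exists2 l, free tau l & l \notin [:: j; i].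
  by apply: free_other => //; rewrite tc.
rewrite !inE negb_or => /andP[lj li]; split.
  move=> a b fa fb aj ib.
  have [jl|jl|E] := ltngtP l j; last by move: lj; rewrite E eqxx.
    by apply: (outer j i l) => //; rewrite jl.
  have [il|il|E] := ltngtP i l; last by move: li; rewrite E eqxx.
    by apply: (outer j i l) => //; rewrite il orbT.
  (* For l between j and i, compose the pairs (j, l) and (l, i); each is bounded by [outer], with i
     respectively j as the outside position. *)
  have lb := ltn_trans il ib; have al := ltn_trans aj jl.
  have neqE := (neq2 _ _ jl, neq2 _ _ il, neq2 _ _ ji).
  rewrite -(gapc_mid aj jl il ib).
  apply: (@corr_le_compose _ _ _ _ w0 _ (slot l)) => //.
  - by have /andP[] := gapc_bounds al il ib.
  - apply: cond_corr_wt => //.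
    by apply: (zero l j i l); rewrite ?eqxx ?orbT ?neqE.
  - by apply: (outer j l i) => //; rewrite il orbT.
  - by apply: (outer l i j) => //; rewrite jl.
(* Trickling down with al = 0 gives 0 for any be < 1. The middle variable is whichever of j and i
   lies on the same side of m as l. *)
move=> m /andP[jm mi] fm.
have fm' n : ~~ free tau m || (m == n) by rewrite fm.
pose be x y := gapc 0 (minn x y) (maxn x y) d.+1.
have be01 x y : free tau x -> free tau y -> x != y -> 0 <= be x y < 1.
  move=> /bd[x0 xd] /bd[y0 yd] xy; rewrite /be.
  by case: ltngtP xy => // xy _; apply: gapc_bounds.
have weak n x y : free tau n -> free tau x -> free tau y -> x != y -> x != n -> y != n ->
    forall v, v \in part n -> v |: tau \in X ->
    corr_le (wt (v |: tau)) (slot x) (slot y) (be x y).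
  move=> fn fx fy xy xn yn v vn vX; apply: gap_corr_weak => //; first exact: IHl fn vn vX.
  - by rewrite (free_add _ fn vn) fx.
  - by rewrite (free_add _ fn vn) fy.
have jl : j != l by rewrite eq_sym.
have il : i != l by rewrite eq_sym.
have ij := neqL _ _ ji; have ij' := neqG _ _ ji.
have [lm|lm|E] := ltngtP l m; last by move: fm; rewrite -E fl.
  apply: corr_le_sym => //; rewrite -(mul0r (1 - be j l)^-1).
  apply: (trickle_wt tX tc fi fj fl) => //.
  - exact: be01.
  - by apply: sym => //; apply: (zero l j i m).
  - exact: weak.
  - by apply: sym => //; apply: (zero j l i m).
rewrite -(mul0r (1 - be i l)^-1).
apply: (trickle_wt tX tc fj fi fl) => //.
- exact: be01.
- by apply: (zero l j i m).
- exact: weak.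
- by apply: (zero i j l m).
Qed.

End Induction.

(** * Summation of the pair bounds over all free positions *)

(** The nearest non-free positions on either side; they exist because 0 and all numbers above d are
    non-free. *)
Lemma gap_functions tau : exists lo hi : nat -> nat, forall j, free tau j ->
  [/\ (lo j < j)%N, (j < hi j)%N, (hi j <= d.+1)%N,
      ~~ free tau (lo j) /\ ~~ free tau (hi j)
    & forall n, (lo j < n < hi j)%N -> free tau n].
Proof.
have big_nonfree n : (d < n)%N -> ~~ free tau n.
  by move=> dn; rewrite /free [(n <= d)%N]leqNgt dn andbF.
have exhi j : exists n, (j < n)%N && ~~ free tau n.
  by exists (maxn j d).+1; rewrite ltnS leq_maxl big_nonfree // ltnS leq_maxr.
have exlo j : exists n, (n <= j)%N && ~~ free tau n by exists 0%N.
have bdlo j n : (n <= j)%N && ~~ free tau n -> (n <= j)%N by case/andP.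
exists (fun j => ex_maxn (exlo j) (bdlo j)), (fun j => ex_minn (exhi j)) => j fj.
case: ex_maxnP => a /andP[aj fa] amax; case: ex_minnP => b /andP[jb fb] bmin.
split=> //.
- by rewrite ltn_neqAle aj andbT; apply: contraNneq fa => ->.
- by apply: bmin; rewrite big_nonfree // andbT ltnS; case/andP: fj => /andP[].
move=> n /andP[an nb]; apply: contraT => fn.
have [nj|jn] := leqP n j.
  by have := amax n; rewrite nj fn leqNgt an => /(_ isT).
by have := bmin n; rewrite jn fn leqNgt nb => /(_ isT).
Qed.

Lemma sum_range x n : \sum_(x.+1 <= i < x.+1 + n) (i%:R : R) = n%:R * x%:R + n%:R * (n%:R + 1) / 2.
Proof.
elim: n => [|n IHn]; first by rewrite addn0 big_geq // !mul0r addr0.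
rewrite addnS big_nat_recr /= ?leq_addr // IHn natrD -natr1 -[n.+1%:R]natr1.
by field.
Qed.

Lemma big_ord_range x y N (F : nat -> R) : (y <= N)%N ->
  \sum_(i < N | (x < i < y)%N) F i = \sum_(x.+1 <= i < y) F i.
Proof.
move=> yN; rewrite (big_nat_widen _ _ N) // (big_nat_widenl _ 0) // big_mkord.
by apply: eq_bigl => i; rewrite andbC.
Qed.

Lemma sum_upper j b : (j < b)%N -> (b <= d.+1)%N ->
  \sum_(i < d.+1 | (j < i < b)%N) (b%:R - i%:R) / (b%:R - j%:R) = (b%:R - j%:R - 1) / 2 :> R.
Proof.
move=> jb bd; rewrite (big_ord_range _ (fun i => (b%:R - i%:R) / (b%:R - j%:R))) //.
rewrite -mulr_suml sumrB -(subnKC jb) sum_range big_const_nat iter_addr_0.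
set n := (b - j.+1)%N; rewrite addKn natrD -natr1 -mulr_natl.
by field; apply/eqP; have := ler0n R n; lra.
Qed.

Lemma sum_lower j a : (a < j)%N -> (j <= d.+1)%N ->
  \sum_(i < d.+1 | (a < i < j)%N) (i%:R - a%:R) / (j%:R - a%:R) = (j%:R - a%:R - 1) / 2 :> R.
Proof.
move=> aj jd; rewrite (big_ord_range _ (fun i => (i%:R - a%:R) / (j%:R - a%:R))) //.
rewrite -mulr_suml sumrB -(subnKC aj) sum_range big_const_nat iter_addr_0.
set n := (j - a.+1)%N; rewrite addKn natrD -natr1 -mulr_natl.
by field; apply/eqP; have := ler0n R n; lra.
Qed.

(** Each pair covariance is split between the two variances with weights u; the weights charged to
    one position total at most (k + 1)/2, the factor required by [link_walkP]. *)
Lemma gap_corr_lambda2 k tau : tau \in X -> codim d tau = k.+2 -> gap_corr tau ->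
  lambda2 (link_walk X d mu tau) <= 1 / 2.
Proof.
move=> tX tc G; apply/(link_walkP tX tc) => f f0; set w := wt tau in f0 *.
have w0 s : 0 <= w s by apply: wt_ge0.
have [lo [hi gapP]] := gap_functions tau.
(* Within one gap, u j i times u i j is the bridge constant [gapc]; pairs in different gaps get
   weight 0. *)
pose u j i : R := if (lo j < i < hi j)%N then
    if (j < i)%N then ((hi j)%:R - i%:R) / ((hi j)%:R - j%:R)
    else (i%:R - (lo j)%:R) / (j%:R - (lo j)%:R)
  else 0.
pose g (A : {set V}) := \sum_(x in A) f x.
pose C j i := cov w (g \o slot j) (g \o slot i).
have pair_lt j i : free tau j -> free tau i -> (j < i)%N ->
    (* Either [hi j] separates j from i and the covariance is 0, or both lie in the same gap, share
       its ends, and [corr_le_balanced] applies. *)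
    2 * C j i <= u j i * C j j + u i j * C i i.
  move=> fj fi ji.
  have [loj hij hid [flo fhi] mid] := gapP j fj.
  have [loi hii hidi [floi fhii] midi] := gapP i fi.
  have [Gap Zero] := G j i ji fj fi.
  have [ib|bi] := ltnP i (hi j); last first.
    have {}bi : (hi j < i)%N by rewrite ltn_neqAle bi andbT; apply: contraNneq fhi => ->.
    have jlo : (hi j <= lo i)%N.
      rewrite leqNgt; apply: contra fhi => lt; apply: midi; lia.
    have -> : u j i = 0 by rewrite /u [(i < hi j)%N]ltnNge (ltnW bi) andbF.
    have -> : u i j = 0 by rewrite /u ltnNge (ltnW (leq_trans hij jlo)).
    rewrite !mul0r addr0 /C corr_le_indep ?mulr0 //.
    by apply: (Zero (hi j)) => //; rewrite hij bi.
  have Elo : lo i = lo j.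
    apply/eqP; rewrite eqn_leq; apply/andP; split.
      by rewrite leqNgt; apply: contra floi => lt; apply: mid; lia.
    by rewrite leqNgt; apply: contra flo => lt; apply: midi; lia.
  have Ehi : hi i = hi j.
    apply/eqP; rewrite eqn_leq; apply/andP; split.
      by rewrite leqNgt; apply: contra fhi => lt; apply: midi; lia.
    by rewrite leqNgt; apply: contra fhii => lt; apply: mid; lia.
  have -> : u j i = ((hi j)%:R - i%:R) / ((hi j)%:R - j%:R).
    by rewrite /u ji ib (ltn_trans loj ji).
  have -> : u i j = (j%:R - (lo j)%:R) / (i%:R - (lo j)%:R).
    by rewrite /u Elo Ehi loj hij ltnNge (ltnW ji).
  have {}Gap := Gap _ _ flo fhi loj ib.
  move: loj ji ib; rewrite -!(ltr_nat R) => loj' ji' ib'.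
  apply: (corr_le_balanced Gap).
    by rewrite divr_gt0 // subr_gt0 //; lra.
  by rewrite /gapc; field; apply/andP; split; apply/eqP; lra.
have pair_neq j i : free tau j -> free tau i -> j != i ->
    2 * C j i <= u j i * C j j + u i j * C i i.
  move=> fj fi; case: ltngtP => // ji _; first exact: pair_lt.
  by rewrite /C covC addrC; apply: pair_lt.
have usum (j : 'I_d.+1) : free tau j ->
    \sum_(i < d.+1 | free tau i && (i != j)) u j i <= k.+1%:R / 2.
  move=> fj; have [loj hij hid _ mid] := gapP j fj.
  have -> : \sum_(i < d.+1 | free tau i && (i != j)) u j i
      = \sum_(i < d.+1 | (j < i < hi j)%N) ((hi j)%:R - i%:R) / ((hi j)%:R - j%:R)
        + \sum_(i < d.+1 | (lo j < i < j)%N) (i%:R - (lo j)%:R) / (j%:R - (lo j)%:R).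
    rewrite big_mkcond [X in _ = X + _]big_mkcond [X in _ = _ + X]big_mkcond -big_split /=.
    apply: eq_bigr => i _; rewrite -val_eqE /u /=.
    case: (boolP (lo j < i < hi j)%N) => [lih|out].
      rewrite (mid _ lih) /=; case/andP: lih => li ih; rewrite li ih /=.
      by case: ltngtP => // ij; rewrite ?addr0 ?add0r.
    rewrite if_same; case: ifP => [h1|_]; first by exfalso; lia.
    by case: ifP => [h1|_]; [exfalso; lia | rewrite addr0].
  (* The two sums add up to (hi - lo - 2)/2, half the number of other positions in the gap. All hi -
     lo - 1 positions of the gap are free, so there are at most k + 2 of them. *)
  rewrite sum_upper // sum_lower //; last by case/andP: fj => /andP[_ /leqW].
  have sub : all (free tau) (iota (lo j).+1 (hi j - (lo j).+1)).
    by apply/allP => n; rewrite mem_iota => H; apply: mid; lia.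
  have := free_size tX (iota_uniq _ _) sub; rewrite size_iota tc -(ler_nat R).
  have lh : ((lo j).+1 <= hi j)%N by lia.
  rewrite natrB // -(natr1 k.+1) -(natr1 (lo j)); lra.
have S_split : wsum w (fun s => (\sum_(x in s :\: tau) f x) ^+ 2)
    = \sum_(j < d.+1 | free tau j) \sum_(i < d.+1 | free tau i) C j i.
  rewrite -(eq_wsum _ (fun s => esym (expr2 _))) -cov_centered //.
  rewrite (@eq_cov_wt tau _ (fun s => \sum_(i < d.+1 | free tau i) g (slot i s)) _
    (fun s => \sum_(i < d.+1 | free tau i) g (slot i s))); first last.
  - by move=> s sX ts; apply: sum_free.
  - by move=> s sX ts; apply: sum_free.
  by rewrite cov_suml; apply: eq_bigr => j _; rewrite cov_sumr.
(* Only the sum of the slot functions is centred, so for the single ones the variance is merely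
   bounded by the second moment. *)
have N_split : \sum_(j < d.+1 | free tau j) C j j
    <= wsum w (fun s => \sum_(x in s :\: tau) f x ^+ 2).
  have -> : wsum w (fun s => \sum_(x in s :\: tau) f x ^+ 2)
     = \sum_(j < d.+1 | free tau j) wsum w (fun s => g (slot j s) ^+ 2).
    transitivity (wsum w (fun s => \sum_(j < d.+1 | free tau j) g (slot j s) ^+ 2)).
      apply: eq_wsum_wt => s sX ts; rewrite sum_free //; apply: eq_bigr => j fj.
      by apply: sum_slot => //; case/andP: fj.
    by rewrite /wsum exchange_big; apply: eq_bigr => s _; rewrite mulr_sumr.
  by apply: ler_sum => j _; apply: cov_le_wsum.
have k0 : 0 <= 1 + k.+1%:R / 2 :> R by have := ler0n R k.+1; lra.
apply: le_trans (ler_wpM2l k0 N_split); rewrite S_split.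
have diag : \sum_(j < d.+1 | free tau j) \sum_(i < d.+1 | free tau i) C j i
    = \sum_(j < d.+1 | free tau j) C j j
      + \sum_(j < d.+1 | free tau j) \sum_(i < d.+1 | free tau i && (i != j)) C j i.
  by rewrite -big_split; apply: eq_bigr => j fj; rewrite (bigD1 j).
have off : 2 * \sum_(j < d.+1 | free tau j) \sum_(i < d.+1 | free tau i && (i != j)) C j i
    <= 2 * \sum_(j < d.+1 | free tau j) \sum_(i < d.+1 | free tau i && (i != j)) u j i * C j j.
  (* Exchanging j and i shows that both weight terms of the pair bounds contribute the same double
     sum. *)
  have swap : \sum_(j < d.+1 | free tau j) \sum_(i < d.+1 | free tau i && (i != j)) u i j * C i i
      = \sum_(j < d.+1 | free tau j) \sum_(i < d.+1 | free tau i && (i != j)) u j i * C j j.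
    rewrite (exchange_big_dep (fun i : 'I_d.+1 => free tau i)) /=; last by move=> i j _ /andP[].
    apply: eq_bigr => i fi; apply: eq_bigl => j.
    by rewrite fi /= eq_sym.
  rewrite [X in _ <= X]mulrDl mul1r -{2}swap -big_split mulr_sumr; apply: ler_sum => j fj.
  rewrite -big_split mulr_sumr; apply: ler_sum => i /andP[fi ij] /=.
  by apply: pair_neq => //; rewrite eq_sym val_eqE.
rewrite diag mulrDl mul1r lerD2l.
have {}off := off; rewrite ler_pM2l // in off.
apply: le_trans off _; rewrite mulr_sumr; apply: ler_sum => j fj.
by rewrite -mulr_suml ler_wpM2r ?cov_ge0 ?usum.
Qed.

End Complex.

Theorem mainTheorem1 (R : realType) (V : finType) (d : nat)
    (X : {set {set V}}) (T : 'I_d -> {set V}) (mu : {set V} -> R)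
    (X_complex : simplicial_complex X) (X_pure : pure X d)
    (X_partite : partite X T)
    (mu_distr : facet_distribution X d mu)
    (X_connected : connected_complex X d)
    (X_path : top_link_path_complex X T mu)
    (X_top_link : top_link_spectral_expander X d mu (1 / 2)) :
  local_spectral_expander X d mu (1 / 2).
Proof.
case: X_path => p path tau tX tc.
have [k tk] : exists k, codim d tau = k.+2.
  by case: (codim d tau) tc => [|[|k]] // _; exists k.
by apply: (gap_corr_lambda2 (T := T) (p := p) _ _ _ _ tX tk) => //; apply: gap_corr_all tk.
Qed.
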